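(* Let $V$ be a set of $n$ distinct positive integers. Then $$\mathrm{ML}(V)\geqslant \frac{1}{2n}+\frac{1}{n^{5/3+o(1)}},$$ where $o(1)$ denotes a quantity tending to $0$ as $n\to\infty$, uniformly over all such $V$. Explicitly: for every $\varepsilon>0$ there exists $n_0=n_0(\varepsilon)$ such that for all $n\geqslant n_0$ and every set $V$ of $n$ distinct positive integers, $\mathrm{ML}(V)\geqslant \frac{1}{2n}+\frac{1}{n^{5/3+\varepsilon}}$.
   Context: Let $\mathbf{T}=\mathbf{R}/\mathbf{Z}$ and for $x\in\mathbf{R}$ (or $x\in\mathbf{T}$) let $\lVert x\rVert_{\mathbf{T}}$ denote the distance from $x$ to the nearest integer. For a finite nonempty set $V$ of positive integers, its maximum loneliness is $\mathrm{ML}(V):=\max_{t\in\mathbf{T}}\min_{v\in V}\lVert tv\rVert_{\mathbf{T}}$. *)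

(* Defs.v *)
From mathcomp Require Export all_boot all_order all_algebra finmap.
From mathcomp Require Export all_classical all_reals all_analysis.
From mathcomp Require Import lra.

Set Implicit Arguments.
Unset Strict Implicit.
Unset Printing Implicit Defensive.

Import Order.TTheory GRing.Theory Num.Theory numFieldNormedType.Exports.

Local Open Scope classical_set_scope.
Local Open Scope ring_scope.

Definition dist_int (R : realType) (x : R) : R :=
  inf [set `|x - m%:~R| | m in [set: int]].

(* The infimum over the finite nonempty set V is a minimum: see
   [loneliness_at_min]. *)
Definition loneliness_at (R : realType) (V : {fset nat}) (t : R) : R :=
  inf [set dist_int (t * v%:R) | v in [set` V]].

(* A point of R/Z is given by a real representative t; by
   [loneliness_at_period] the choice is immaterial.  For V nonempty the
   supremum is a maximum: see [ML_max]. *)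
Definition ML (R : realType) (V : {fset nat}) : R :=
  sup [set loneliness_at V t | t in [set: R]].

Section Loneliness.
Variable R : realType.
Implicit Types (x y t : R) (V : {fset nat}).

Lemma dist_int_le x (m : int) : dist_int x <= `|x - m%:~R|.
Proof.
by apply: ge_inf; [exists 0 => _ [k _ <-]; exact: normr_ge0|exists m].
Qed.

Lemma le_dist_int x a : (forall m : int, a <= `|x - m%:~R|) -> a <= dist_int x.
Proof.
move=> h; apply: lb_le_inf; first by exists `|x - 0%:~R|, 0.
by move=> _ [k _ <-].
Qed.

Lemma dist_int_ge0 x : 0 <= dist_int x.
Proof. by apply: le_dist_int => m. Qed.

Lemma dist_int_lip x y : dist_int x <= dist_int y + `|x - y|.
Proof.
rewrite -lerBlDr; apply: le_dist_int => m; rewrite lerBlDr addrC.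
by apply: le_trans (ler_distD y x m%:~R); exact: dist_int_le.
Qed.

Lemma dist_int_period x (m : int) : dist_int (x + m%:~R) = dist_int x.
Proof.
apply/eqP; rewrite eq_le; apply/andP; split; apply: le_dist_int => k.
  rewrite -(addrKA m%:~R) -intrD.
  exact: dist_int_le.
by have := dist_int_le x (k - m); rewrite intrB opprB addrA.
Qed.

Lemma loneliness_at_le V t v : v \in V ->
  loneliness_at V t <= dist_int (t * v%:R).
Proof.
move=> vV; apply: ge_inf; last by exists v.
by exists 0 => _ [k _ <-]; exact: dist_int_ge0.
Qed.

Lemma loneliness_at_min V t : V != fset0 ->
  exists2 v, v \in V & loneliness_at V t = dist_int (t * v%:R).
Proof.
case/fset0Pn => v0 v0V.
pose F (u : V) := dist_int (t * (fsval u)%:R).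
have [u _ minu] := Order.TotalTheory.arg_minP (P := predT) (i0 := [` v0V]%fset) F erefl.
exists (fsval u); first exact: fsvalP.
apply/eqP; rewrite eq_le loneliness_at_le ?fsvalP//=.
apply: lb_le_inf; first by exists (dist_int (t * v0%:R)), v0.
by move=> _ [v vV <-]; exact: (minu [` vV]%fset).
Qed.

Lemma loneliness_at_period V t (m : int) :
  loneliness_at V (t + m%:~R) = loneliness_at V t.
Proof.
congr inf; apply: eq_imagel => v _.
by rewrite mulrDl (pmulrn 1 v) -intrM dist_int_period.
Qed.

Lemma loneliness_at_lip V t s : V != fset0 ->
  loneliness_at V t <=
  loneliness_at V s + (\sum_(v <- V) v%:R) * `|t - s|.
Proof.
move=> V0; have [v vV ->] := loneliness_at_min s V0.
apply: le_trans (loneliness_at_le t vV) _.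
apply: le_trans (dist_int_lip _ (s * v%:R)) _.
rewrite lerD2l -mulrBl normrM normr_nat mulrC ler_wpM2r//.
by rewrite (big_fsetD1 v)//= lerDl sumr_ge0.
Qed.

Lemma continuous_loneliness_at V : V != fset0 ->
  continuous (@loneliness_at R V).
Proof.
move=> V0 t; set L : R := \sum_(v <- V) v%:R.
have L0 : 0 <= L by rewrite sumr_ge0.
apply/cvgrPdist_le => e e0.
have d0 : 0 < e / (L + 1) by rewrite divr_gt0//; lra.
near=> s.
have ts : `|t - s| <= e / (L + 1).
  by near: s; apply: (cvgr_dist_le (F := nbhs t)) d0; exact: cvg_id.
have Le : L * `|t - s| <= e.
  rewrite (le_trans (ler_wpM2l L0 ts))// mulrCA ler_piMr ?(ltW e0)//.
  by rewrite ler_pdivrMr; lra.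
have := loneliness_at_lip t s V0; have := loneliness_at_lip s t V0.
rewrite (distrC s t) -/L ler_norml => h1 h2.
by apply/andP; split; lra.
Unshelve. all: by end_near. Qed.

Lemma ML_max V : V != fset0 ->
  exists2 t, ML R V = loneliness_at V t &
    forall s, loneliness_at V s <= loneliness_at V t.
Proof.
move=> V0.
have [c _ cmax] := @EVT_max R (@loneliness_at R V) 0 1 ler01
  (continuous_subspaceT (continuous_loneliness_at V0)).
have cub s : loneliness_at V s <= loneliness_at V c.
  rewrite -[s](subrK (Num.floor s)%:~R) loneliness_at_period; apply: cmax.
  have := floor_itv s; rewrite intrD in_itv/= => /andP[? ?].
  by apply/andP; split; lra.
exists c => //; apply/eqP; rewrite eq_le; apply/andP; split.
  by apply: ge_sup; [exists (loneliness_at V c), c|move=> _ [s _ <-]].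
apply: ub_le_sup; last by exists c.
by exists (loneliness_at V c) => _ [s _ <-].
Qed.

End Loneliness.

(* Main.v *)
Require Import Defs.
From mathcomp Require Import ring lra zify.

(** Write [||x||] for the distance to the nearest integer and suppose that the
Bohr sets [B_v = {t : ||t v|| < delta}], [delta = (1 + eta) / 2n], cover the
circle.  Then the covering multiplicity [F] satisfies [F >= 1] and [F - 1] has
integral [eta].  Let [r] be about [n^(1/3)] and call [S] a dissociated subset of
[V] if it satisfies no nontrivial linear relation with coefficients at most [r].

If [V] has a dissociated subset [S] with [d = n^(1/3 - o(1))] elements, let [G]
be the covering multiplicity of the [B_v] with [v] in [S].  By pigeonhole any two
Bohr sets meet in measure at least [1 / 4n^2], so [G (F - 1)] has integral at
least [d / 8n].  By Parseval, [tau] of the Bohr sets of [S] meet in measure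
[O(r^(-tau))], so [G < tau] off a negligible set for a suitable constant [tau].
Hence [eta >= d / (16 n tau)], roughly.

Otherwise each [v] in [V] satisfies [c v = \sum_(s in S) e_s s] for a fixed [S]
with at most [n^(1/3)] elements and coefficients at most [r].  Dirichlet
approximation then lets the speeds be replaced, at negligible cost, by rationals
[y_v / c] with [0 < |y_v| <= exp(n^(2/3 + o(1)))].  So few primes divide some
[y_v] that a prime [p <= n^(5/3 + o(1))] suitably placed modulo [2n] divides none
of them; counting the [a] modulo [p] for which [a] times some new speed is close
to [0] modulo [p] then yields a lonely time [a / p]. *)

Set Implicit Arguments.
Unset Strict Implicit.
Unset Printing Implicit Defensive.

(** * Chebyshev's lower bound and primes in prescribed position *)

Lemma divn_double_le m q : 0 < q -> m.*2 %/ q <= (m %/ q).*2 + (q <= m.*2).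
Proof.
move=> q0; have [qm|qm] := leqP q m.*2; last by rewrite divn_small.
rewrite addn1 -ltnS ltn_divLR//; have := divn_eq m q; have := ltn_pmod m q0.
by move: (m %/ q) (m %% q) => a b; nia.
Qed.

(** By Legendre's formula the exponent of [p] is the sum over [k] of [2m %/ p^k - 2 (m %/ p^k)];
    each term is at most 1 and vanishes once [p^k > 2m]. *)
Lemma pfactor_central_bin p m : prime p -> 0 < m -> p ^ logn p 'C(m.*2, m) <= m.*2.
Proof.
move=> p_pr m0; have p1 := prime_gt1 p_pr; have p0 := prime_gt0 p_pr.
have m20 : 0 < m.*2 by rewrite double_gt0.
apply: leq_trans (trunc_logP p1 m20); rewrite leq_exp2l//.
have Cm0 : 0 < 'C(m.*2, m) by rewrite bin_gt0 -addnn leq_addr.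
have /(congr1 (logn p)) : 'C(m.*2, m) * (m`! * (m.*2 - m)`!) = m.*2`!.
  by rewrite bin_fact// -addnn leq_addr.
rewrite -addnn addnK addnn !lognM ?muln_gt0 ?fact_gt0// !logn_fact//.
have -> : \sum_(1 <= k < m.+1) m %/ p ^ k = \sum_(1 <= k < m.*2.+1) m %/ p ^ k.
  rewrite [RHS](big_cat_nat (n := m.+1)) ?ltnS -?addnn ?leq_addr//=.
  rewrite [X in _ = _ + X]big1_seq ?addn0// => k; rewrite mem_index_iota => /andP[_ /andP[mk _]].
  by rewrite divn_small// (leq_trans mk)// ltnW// ltn_expl.
rewrite -big_split /= => lognE.
suff : \sum_(1 <= k < m.*2.+1) m.*2 %/ p ^ k <=
    \sum_(1 <= k < m.*2.+1) (m %/ p ^ k + m %/ p ^ k) + trunc_log p m.*2.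
  by rewrite -lognE addnC leq_add2l.
have trunc_lt : trunc_log p m.*2 < m.*2.+1.
  by rewrite ltnS ltnW// (leq_trans (ltn_expl _ p1)) ?trunc_logP.
have -> : trunc_log p m.*2 = \sum_(1 <= k < m.*2.+1) (p ^ k <= m.*2).
  rewrite (big_cat_nat (n := (trunc_log p m.*2).+1))//=.
  rewrite [X in _ = _ + X]big1_seq ?addn0; last first.
    move=> k; rewrite mem_index_iota => /andP[_ /andP[tk _]].
    apply/eqP; rewrite eqb0 -ltnNge; apply: leq_trans (trunc_log_ltn _ p1) _.
    by rewrite leq_exp2l.
  rewrite big_nat (eq_bigr (fun=> 1)) -?big_nat ?sum_nat_const_nat ?subn1 ?muln1//.
  move=> k /andP[_ kt]; rewrite (leq_trans _ (trunc_logP p1 m20))//.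
  by rewrite leq_exp2l.
rewrite -big_split /=; apply: leq_sum => k _.
by rewrite addnn divn_double_le// expn_gt0 p0.
Qed.

(** Induction through [(k+1) C(2k+2, k+1) = 2 (2k+1) C(2k, k)]. *)
Lemma central_bin_ge m : 0 < m -> 4 ^ m <= m.*2 * 'C(m.*2, m).
Proof.
elim: m => // -[_ _|m IHm _]; first by [].
set k := m.+1 in IHm *.
have e1 : k.+1 * 'C(k.*2.+2, k.+1) = k.*2.+2 * 'C(k.*2.+1, k).
  by rewrite -mul_bin_diag.
have e2 : k.+1 * 'C(k.*2.+1, k) = k.*2.+1 * 'C(k.*2, k).
  by have := mul_bin_down k.*2.+1 k; rewrite /= -addnn -addnS addKn.
have := IHm isT; rewrite expnS doubleS.
by move: e1 e2; move: 'C(_, _) 'C(_, _) 'C(_, _) => a b c; nia.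
Qed.

Lemma prod_primes_logn n : 0 < n -> n = \prod_(p <- primes n) p ^ logn p n.
Proof.
by move=> n0; rewrite {1}[n]prod_prime_decomp// prime_decompE big_map.
Qed.

(* Erdos's proof of Chebyshev's bound: [p ^ logn p 'C(2m, m) <= 2m] for every
   prime [p], so ['C(2m, m)] is at most [2m] to the number of primes up to [2m]. *)
Lemma primes_lower_bound m : 0 < m ->
  4 ^ m <= m.*2 ^ (size [seq p <- iota 0 m.*2.+1 | prime p]).+1.
Proof.
move=> m0; apply: leq_trans (central_bin_ge m0) _; rewrite expnS leq_mul2l.
have Cm0 : 0 < 'C(m.*2, m) by rewrite bin_gt0 -addnn leq_addr.
apply/orP; right; rewrite [leqLHS]prod_primes_logn//.
have le_prod s : all prime s -> \prod_(p <- s) p ^ logn p 'C(m.*2, m) <= m.*2 ^ size s.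
  elim: s => [|p s IHs] /=; first by rewrite big_nil.
  by case/andP => p_pr s_pr; rewrite big_cons expnS leq_mul ?pfactor_central_bin ?IHs.
apply: leq_trans (le_prod _ _) _.
  by apply/allP => p; rewrite mem_primes => /andP[].
rewrite leq_pexp2l ?double_gt0// uniq_leq_size ?primes_uniq// => p.
rewrite mem_primes mem_filter mem_iota /= ltnS => /and3P[p_pr _ pC]; rewrite p_pr/=.
apply: leq_trans (pfactor_central_bin p_pr m0).
rewrite -[leqLHS]expn1 leq_exp2l ?prime_gt1// logn_gt0 mem_primes p_pr Cm0//.
Qed.

Lemma size_primes_le n : 0 < n -> 2 ^ size (primes n) <= n.
Proof.
move=> n0; rewrite [leqRHS]prod_primes_logn//.
have : {subset primes n <= primes n} by [].
elim: {1 3 4}(primes n) => [|p s IHs] sub; first by rewrite big_nil.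
rewrite big_cons /= expnS leq_mul ?IHs//; last by move=> q qs; rewrite sub ?inE ?qs ?orbT.
have pn : p \in primes n by rewrite sub ?mem_head.
have p_pr : prime p by move: pn; rewrite mem_primes => /andP[].
apply: leq_trans (prime_gt1 p_pr) _; rewrite -[leqLHS]expn1 leq_exp2l ?prime_gt1//.
by rewrite logn_gt0.
Qed.

(** There are at least [X / l - 1] primes up to [X = 2nJ]. At most [B] of them divide [Y], and at
    most [J * s] have [p - 2] in the last [s] classes modulo [2n], so one survives. *)
Lemma ex_good_prime (n s J l B Y : nat) :
    0 < n -> 0 < J -> 0 < Y -> Y <= 2 ^ B -> n.*2 * J <= 2 ^ l ->
    l * (B + J * s).+1 < n.*2 * J ->
  exists p, [/\ prime p, p <= n.*2 * J, ~~ (p %| Y) & (p - 2) %% n.*2 < n.*2 - s].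
Proof.
move=> n0 J0 Y0 YB Xl lX; set X := n.*2 * J.
pose bad := [seq 2 + (n.*2 * j + i) | j <- iota 0 J, i <- iota (n.*2 - s) s].
pose P := [seq p <- iota 0 X.+1 | prime p].
have [/hasP[p]|/hasPn noP] := boolP (has (fun p => p \notin primes Y ++ bad) P).
  rewrite mem_filter mem_iota /= ltnS => /andP[p_pr pX].
  rewrite mem_cat mem_primes p_pr Y0 negb_or /= => /andP[pY pbad].
  exists p; split=> //; rewrite ltnNge; apply: contra pbad => sp.
  have n20 : 0 < n.*2 by rewrite double_gt0.
  apply/allpairsP; exists ((p - 2) %/ n.*2, (p - 2) %% n.*2); rewrite !mem_iota /=; split.
  - have X0 : 0 < X by rewrite muln_gt0 n20.
    by rewrite ltn_divLR// mulnC -/X; have := prime_gt1 p_pr; lia.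
  - rewrite sp /=; have := ltn_pmod (p - 2) n20; lia.
  - by rewrite mulnC -divn_eq subnKC// prime_gt1.
have : size P <= size (primes Y ++ bad).
  rewrite uniq_leq_size ?filter_uniq ?iota_uniq// => p /noP.
  by rewrite negbK.
rewrite size_cat size_allpairs !size_iota => PB.
have YsB : size (primes Y) <= B.
  by rewrite -(leq_exp2l _ _ (isT : 1 < 2)) (leq_trans (size_primes_le Y0)).
have X2 : X = (n * J).*2 by rewrite /X doubleMl.
have := @primes_lower_bound (n * J); rewrite muln_gt0 n0 J0 -X2 -/P => /(_ isT).
rewrite -[4]/(2 ^ 2) -expnM mul2n -X2.
move=> Xle; exfalso; move: Xle; apply/negP; rewrite -ltnNge.
apply: (@leq_ltn_trans (2 ^ (l * (size P).+1))); first by rewrite expnM leq_exp2r.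
rewrite ltn_exp2l// (leq_ltn_trans _ lX)// leq_mul2l ltnS.
by rewrite (leq_trans PB) ?orbT// leq_add2r.
Qed.

Import Order.TTheory GRing.Theory Num.Theory.

Local Open Scope ring_scope.

(** * Counting in Bohr sets *)

Section DistInt.
Variable R : realType.
Implicit Types x y : R.

Lemma dist_int_lt x e : dist_int x < e -> exists m : int, `|x - m%:~R| < e.
Proof.
rewrite /dist_int => /inf_lt[|_ [m _ <-] xm]; last by exists m.
by exists `|x - 0%:~R|, 0.
Qed.

Lemma dist_int_norm x : dist_int x <= `|x|.
Proof. by have := dist_int_le x 0; rewrite subr0. Qed.

Lemma dist_intN x : dist_int (- x) = dist_int x.
Proof.
suff le_N y : dist_int (- y) <= dist_int y.
  by apply/eqP; rewrite eq_le le_N/=; have := le_N (- x); rewrite opprK.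
apply: le_dist_int => m; have := dist_int_le (- y) (- m).
by rewrite intrN opprK addrC distrC.
Qed.

Lemma dist_intD x y : dist_int (x + y) <= dist_int x + dist_int y.
Proof.
rewrite -lerBlDl; apply: le_dist_int => m.
have := dist_int_lip (x + y) (x + m%:~R); rewrite dist_int_period.
by rewrite [x + y]addrC addrKA; lra.
Qed.

Lemma dist_int_sum (I : finType) (P : pred I) (f : I -> R) :
  dist_int (\sum_(i | P i) f i) <= \sum_(i | P i) dist_int (f i).
Proof.
elim/big_ind2: _ => // [|a a' b b' ? ?].
  by rewrite (le_trans (dist_int_norm _))// normr0.
by rewrite (le_trans (dist_intD _ _))// lerD.
Qed.

Lemma dist_int_natM (k : nat) x : dist_int (k%:R * x) <= k%:R * dist_int x.
Proof.
elim: k => [|k IHk].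
  by rewrite !mul0r (le_trans (dist_int_norm _))// normr0.
rewrite -natr1 !mulrDl !mul1r (le_trans (dist_intD _ _))//.
by rewrite lerD2r.
Qed.

Lemma dist_int_modn (a L : nat) : (0 < L)%N ->
  dist_int ((a %% L)%:R / L%:R) = dist_int (a%:R / L%:R : R).
Proof.
move=> L0; have L0' : (L%:R : R) != 0 by rewrite pnatr_eq0 -lt0n.
rewrite [in RHS](divn_eq a L) natrD natrM mulrDl mulfK// addrC.
by rewrite -[(a %/ L)%:R]/((a %/ L)%:Z%:~R) dist_int_period.
Qed.

Lemma card_dist_int_lt (L r : nat) : (0 < L)%N ->
  (#|[set b : 'I_L | (dist_int (b%:R / L%:R : R) < r%:R / L%:R)%R]| <= r.*2.-1)%N.
Proof.
move=> L0; have L0' : (0 : R) < L%:R by rewrite ltr0n.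
set A := [set _ | _].
have subA (b : 'I_L) : b \in A -> (b < r)%N || (L < b + r)%N.
  rewrite inE => /dist_int_lt[m].
  have -> : b%:R / L%:R - m%:~R = (b%:Z - m * L%:Z)%:~R / L%:R :> R.
    by rewrite intrB intrM mulrBl mulfK ?gt_eqF.
  rewrite normrM normfV normr_nat ltr_pM2r ?invr_gt0// -intr_norm.
  rewrite -[r%:R]/(r%:Z%:~R) ltr_int => h.
  have := ltn_ord b; have [m0|m1] := leP m 0.
    have : 0 <= - m * L%:Z by rewrite mulr_ge0// oppr_ge0.
    by rewrite mulNr; lia.
  have : 0 <= (m - 1) * L%:Z by rewrite mulr_ge0// subr_ge0.
  by rewrite mulrBl mul1r; lia.
have [r0|r0] := posnP r.
  rewrite eq_card0// => b; apply/negbTE/negP => /subA.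
  by rewrite r0 addn0 ltn0 ltnNge ltnW.
(* The admissible [b] are [0, ..., r-1] and [L-r+1, ..., L-1]; [g] numbers the second range
   downwards from [L-1], after the first. *)
pose g (b : nat) := if (b < r)%N then b else (r.-1 + (L - b))%N.
pose f (b : 'I_L) : 'I_(r.-1.*2.+1) := inord (g b).
have -> : r.*2.-1 = #|'I_(r.-1.*2.+1)| by rewrite card_ord; lia.
have gA b : b \in A -> (g b < r.-1.*2.+1)%N.
  by move=> /subA; rewrite /g; have := ltn_ord b; case: (ltnP b r); lia.
rewrite -(card_in_imset (f := f)) ?max_card// => b b' bA b'A.
move=> /(congr1 (@nat_of_ord _)); rewrite !inordK ?gA// => gbb; apply/val_inj => /=.
move: gbb; have := ltn_ord b; have := ltn_ord b'; rewrite /g.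
by case: (ltnP b r); case: (ltnP b' r); lia.
Qed.

Lemma card_dist_int_mul_lt (L r w s : nat) : (0 < L)%N -> coprime L w ->
  (#|[set b : 'I_L |
     (dist_int ((b%:R - s%:R) * w%:R / L%:R : R) < r%:R / L%:R)%R]| <= r.*2.-1)%N.
Proof.
move=> L0 cLw; have L0' : (L%:R : R) != 0 by rewrite pnatr_eq0 -lt0n.
(* Adding [s * (L-1)] subtracts [s] modulo [L] within [nat]; the resulting affine map permutes the
   residues. *)
pose g (b : nat) := ((b + s * L.-1) * w %% L)%N.
have gL b : (g b < L)%N by rewrite ltn_mod.
pose f (b : 'I_L) : 'I_L := Ordinal (gL b).
have f_inj : injective f.
  suff f_le (b b' : 'I_L) : (b <= b')%N -> f b = f b' -> b = b'.
    move=> b b' ff; have [bb|/ltnW bb] := leqP b b'; first exact: f_le.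
    by apply/esym/f_le.
  move=> bb /(congr1 (@nat_of_ord _))/= /esym/eqP; rewrite /g.
  rewrite eqn_mod_dvd ?leq_mul2r ?leq_add2r ?bb ?orbT// -mulnBl subnDr.
  rewrite Gauss_dvdl// => Lbb; apply/val_inj/eqP; rewrite eqn_leq bb /=.
  rewrite -subn_eq0; move: Lbb; have := ltn_ord b'.
  have [//|bb0] := posnP (b' - b)%N => bL /(dvdn_leq bb0); lia.
rewrite -(card_imset _ f_inj); apply: leq_trans (card_dist_int_lt r L0).
apply/subset_leq_card/fintype.subsetP => _ /imsetP[b + ->]; rewrite !inE /= dist_int_modn//.
congr (_ < _); rewrite -(dist_int_period _ (s * w)%:Z); congr dist_int.
rewrite -[(s * w)%:~R]/((s * w)%:R) natrM natrM natrD natrM.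
by rewrite -subn1 natrB//; field.
Qed.

End DistInt.

Lemma ex_large_fiber (T T' : finType) (f : T -> T') (t0 : T) :
  exists t, (#|T| <= #|T'| * #|[set u | f u == f t]|)%N.
Proof.
pose F t := #|[set u | f u == f t]|.
have [t _ tmax] := arg_maxnP F (i0 := t0) (P := predT) erefl.
have le_fiber y : (\sum_(u | f u == y) 1 <= F t)%N.
  have [u /eqP fu|nu] := pickP (fun u => f u == y); last by rewrite big1// => u; rewrite nu.
  by rewrite sum1_card -fu -cardsE; exact: tmax.
exists t; rewrite -[leqLHS]sum1_card (partition_big f xpredT)//=.
apply: (@leq_trans (\sum_(y : T') F t)); last by rewrite sum_nat_const.
by apply: leq_sum => y _; exact: le_fiber.
Qed.

(** Cut the torus into [M ^ #|I|] cubes of side [1 / M] and take [a0] in a fullest one. Counting the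
    good [a], instead of producing one, leaves room to discard some of them later. *)
Lemma dirichlet (R : realType) (I : finType) (theta : I -> R) (L M : nat) :
    (0 < L)%N -> (0 < M)%N ->
  exists a0 : 'I_L, (L <= M ^ #|I| * #|[set a : 'I_L |
     [forall i, (dist_int ((a%:R - a0%:R) * theta i) < M%:R^-1)%R]]|)%N.
Proof.
case: L M => // L [//|M] _ _; have M0 : (0 : R) < M.+1%:R by rewrite ltr0n.
pose fr (x : R) := x - (Num.floor x)%:~R.
have fr01 x : 0 <= fr x < 1.
  by rewrite /fr; have := floor_itv x; rewrite intrD => /andP[]; lra.
pose box x : 'I_M.+1 := inord (Num.truncn (M.+1%:R * fr x)).
have boxP x : (box x)%:R <= M.+1%:R * fr x < (box x)%:R + 1.
  have [f0 f1] := andP (fr01 x).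
  have /andP[h1 h2] := truncn_itv (mulr_ge0 (ltW M0) f0).
  rewrite /box inordK; last first.
    rewrite -(ltr_nat R) (le_lt_trans h1)// -[ltRHS]mulr1.
    by rewrite ltr_pM2l.
  by rewrite h1 /= natr1.
pose f (a : 'I_L.+1) := [ffun i => box (a%:R * theta i)].
have [a0 ha0] := ex_large_fiber f ord0.
exists a0; move: ha0; rewrite card_ffun !card_ord => /leq_trans; apply.
rewrite leq_mul2l subset_leq_card ?orbT//; apply/fintype.subsetP => a; rewrite !inE.
move=> /eqP/ffunP fa; apply/forallP => i; have := fa i; rewrite !ffunE => eqb.
have := boxP (a%:R * theta i); have := boxP (a0%:R * theta i); rewrite eqb.
set b := (box _)%:R => /andP[h1 h2] /andP[h3 h4].
rewrite -(dist_int_period _ (Num.floor (a0%:R * theta i) - Num.floor (a%:R * theta i))).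
rewrite (le_lt_trans (dist_int_norm _))//.
have -> : (a%:R - a0%:R) * theta i +
  (Num.floor (a0%:R * theta i) - Num.floor (a%:R * theta i))%:~R =
  fr (a%:R * theta i) - fr (a0%:R * theta i).
  by rewrite /fr intrB; ring.
rewrite -(ltr_pM2l M0) mulfV ?gt_eqF// -[X in X * `|_|](gtr0_norm M0).
by rewrite -normrM ltr_norml mulrBr; apply/andP; split; lra.
Qed.

(** * Cosine sums and a dual large sieve *)

Section DualSieve.
Variable R : realType.
Implicit Types x y : R.

Lemma cosD2piz x (m : int) : cos (2 * pi * (x + m%:~R)) = cos (2 * pi * x).
Proof.
have cosn y (k : nat) : cos (2 * pi * (y + k%:R)) = cos (2 * pi * y).
  rewrite -[RHS](periodicn (@cosD2pi R) k); congr cos.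
  by rewrite -[_ *+ k]mulr_natr -[pi *+ 2]mulr_natr; ring.
case: m => k; first exact: cosn.
by rewrite NegzE intrN -[LHS](cosn _ k.+1) -addrA addNr addr0.
Qed.

Lemma cos_dist_int x : dist_int x < 8^-1 -> 2^-1 <= cos (2 * pi * x).
Proof.
move=> /dist_int_lt[m]; rewrite -[in cos _](subrK m%:~R x) cosD2piz.
move: (x - _) => {}x; rewrite ltr_norml => /andP[x1 x2].
have pi0 := @pi_gt0 R; set y := 2 * pi * x.
have y1 : - pi < 4 * y.
  rewrite -subr_gt0 (_ : _ - _ = pi * (8 * x + 1)); first by rewrite mulr_gt0//; lra.
  by rewrite /y; ring.
have y2 : 4 * y < pi.
  rewrite -subr_gt0 (_ : _ - _ = pi * (1 - 8 * x)); first by rewrite mulr_gt0//; lra.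
  by rewrite /y; ring.
have c0 : 0 < cos y by apply: cos_gt0_pihalf; lra.
have : 0 < cos (y *+ 2) by apply: cos_gt0_pihalf; rewrite -mulr_natr; lra.
rewrite cos_mulr2n -mulr_natr leNgt; move: (cos y) c0 => c c0 c2; apply/negP => c1.
have : c * c < 2^-1 * 2^-1 by rewrite ltr_pM// ltW.
by rewrite -expr2; lra.
Qed.

Lemma sum_cos_eq0 (L : nat) (m : int) : (0 < L)%N -> ~~ (L%:Z %| m)%Z ->
  \sum_(a < L) cos (2 * pi * (a%:R * m%:~R / L%:R)) = 0 :> R.
Proof.
move=> L0 Lm; have L0' : (0 : R) < L%:R by rewrite ltr0n.
have LN0 : L%:R != 0 :> R by rewrite gt_eqF.
have Lz0 : L%:Z != 0 by lia.
have [q [r [mE rL r0]]] : exists q r, [/\ m = q * L%:Z + r%:Z, (r < L)%N & (0 < r)%N].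
  exists (m %/ L)%Z, `|(m %% L)%Z|%N; rewrite gez0_abs ?modz_ge0// -divz_eq.
  split=> //; first by rewrite -ltz_nat gez0_abs ?modz_ge0// ltz_mod.
  by rewrite absz_gt0; apply: contra Lm => /eqP/dvdz_mod0P.
pose h := pi * (r%:R / L%:R) : R.
have sin_h : sin h != 0.
  rewrite gt_eqF// sin_gt0_pi// /h mulr_gt0 ?pi_gt0 ?divr_gt0 ?ltr0n//=.
  by rewrite gtr_pMr ?pi_gt0// ltr_pdivrMr// mul1r ltr_nat.
apply: (mulfI sin_h); rewrite mulr0 mulr_sumr.
(* Multiplication by [sin h] makes the sum telescope: [sin h cos (2ah)] is half of
   [sin ((2a+1)h) - sin ((2a-1)h)]. The end values agree because [2Lh] is a multiple of [2 pi]. *)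
pose u (a : nat) := sin (h * (a.*2%:R - 1)) / 2.
rewrite (eq_bigr (fun a : 'I_L => u a.+1 - u a)); last first.
  move=> a _; rewrite /u mE intrD intrM.
  have -> : a%:R * (q%:~R * L%:~R + r%:~R) / L%:R
      = a%:R * (r%:R / L%:R) + (a%:Z * q)%:~R :> R.
    by rewrite intrM -pmulrn -[r%:~R]/(r%:R); field.
  rewrite cosD2piz.
  have -> : 2 * pi * (a%:R * (r%:R / L%:R)) = h * a.*2%:R.
    by rewrite /h -muln2 natrM; ring.
  rewrite doubleS -addn2 natrD.
  have -> : h * (a.*2%:R + 2 - 1) = h * a.*2%:R + h by ring.
  have -> : h * (a.*2%:R - 1) = h * a.*2%:R - h by ring.
  by rewrite sinD sinB; field.
rewrite -(big_mkord xpredT (fun a => u a.+1 - u a)) telescope_sumr//.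
rewrite /u double0 sub0r mulrN1 sinN -mul2n natrM.
have -> : h * (2 * L%:R - 1) = - h + pi *+ 2 *+ r.
  by rewrite /h -[_ *+ r]mulr_natr -[pi *+ 2]mulr_natr; field.
by rewrite (periodicn (@sinD2pi R)) sinN subrr.
Qed.

Lemma sum_cos_le (L : nat) (m : int) :
  \sum_(a < L) cos (2 * pi * (a%:R * m%:~R / L%:R)) <= L%:R :> R.
Proof.
rewrite -[leRHS](_ : \sum_(a < L) 1 = _); last by rewrite sumr_const card_ord.
by apply: ler_sum => a _; exact: cos_le1.
Qed.

(* Parseval: sum over [a] the square of [\sum_j cos (2 pi a g_j / L)]. *)
Lemma dual_sieve (L : nat) (J : finType) (g : J -> nat) (A : {set 'I_L}) :
    (0 < L)%N -> (forall j k, g j = g k %[mod L] -> j = k) ->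
    (forall a j, a \in A -> dist_int (a%:R * (g j)%:R / L%:R : R) < 8^-1) ->
  (#|A| * #|J| <= 4 * L)%N.
Proof.
move=> L0 g_inj gA.
pose c m := \sum_(a < L) cos (2 * pi * (a%:R * m%:~R / L%:R)) : R.
pose s (a : 'I_L) := \sum_j cos (2 * pi * (a%:R * (g j)%:R / L%:R)) : R.
have lo : \sum_(a in A) (#|J|%:R / 2) ^+ 2 <= \sum_a s a ^+ 2.
  rewrite [leLHS]big_mkcond; apply: ler_sum => a _; case: ifPn => aA; last exact: sqr_ge0.
  have Js : #|J|%:R / 2 <= s a.
    rewrite /s mulr_natl -sumr_const; apply: ler_sum => j _.
    exact/cos_dist_int/gA.
  by rewrite lerXn2r// nnegrE ?divr_ge0// (le_trans _ Js)// divr_ge0.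
(* Only a frequency divisible by [L] contributes, and there is at most one. *)
have c_le (h : J -> int) :
    (forall j k, (L%:Z %| h j)%Z -> (L%:Z %| h k)%Z -> j = k) ->
    \sum_k c (h k) <= L%:R.
  move=> h_inj; have [j Lj|nL] := pickP (fun j => (L%:Z %| h j)%Z).
    rewrite (bigD1 j)//= big1 ?addr0; first exact: sum_cos_le.
    move=> k kj; apply: sum_cos_eq0 => //.
    by apply: contra kj => Lk; apply/eqP/h_inj.
  by rewrite big1// => k _; apply: sum_cos_eq0; rewrite ?nL.
(* By the product-to-sum formula, the frequencies for fixed [j] are [g j + g k] and [g j - g k];
   each family is divisible by [L] for at most one [k]. *)
have hi : \sum_a s a ^+ 2 <= #|J|%:R * L%:R.
  have -> : \sum_a s a ^+ 2 = \sum_j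
     2^-1 * (\sum_k c ((g j)%:Z + (g k)%:Z) + \sum_k c ((g j)%:Z - (g k)%:Z)).
    rewrite (eq_bigr (fun a : 'I_L => \sum_j \sum_k cos (2 * pi * (a%:R * (g j)%:R / L%:R)) *
       cos (2 * pi * (a%:R * (g k)%:R / L%:R)))); last first.
      by move=> a _; rewrite expr2 /s mulr_suml; apply: eq_bigr => j _; rewrite mulr_sumr.
    rewrite exchange_big; apply: eq_bigr => j _; rewrite exchange_big -big_split mulr_sumr.
    apply: eq_bigr => k _; rewrite -big_split mulr_sumr; apply: eq_bigr => a _ /=.
    have cosMcos x y : cos x * cos y = 2^-1 * (cos (x + y) + cos (x - y)).
      by rewrite cosD cosB; field.
    rewrite cosMcos; congr (_ * (cos _ + cos _)).
      by rewrite intrD -!pmulrn; ring.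
    by rewrite intrB -!pmulrn; ring.
  rewrite mulr_natl -sumr_const; apply: ler_sum => j _.
  rewrite mulrC ler_pdivrMr// mulr_natr mulr2n lerD// c_le// => k l.
    move=> /dvdzP[p pE] /dvdzP[q qE]; apply: g_inj.
    apply/eqP; rewrite -eqz_nat -!modz_nat; apply/eqP.
    have -> : (g k)%:Z = (p - q) * L%:Z + (g l)%:Z by rewrite mulrBl -pE -qE; ring.
    by rewrite modzMDl.
  move=> /dvdzP[p pE] /dvdzP[q qE]; apply: g_inj.
  apply/eqP; rewrite -eqz_nat -!modz_nat; apply/eqP.
  have -> : (g k)%:Z = (q - p) * L%:Z + (g l)%:Z by rewrite mulrBl -pE -qE; ring.
  by rewrite modzMDl.
have := le_trans lo hi; rewrite sumr_const -mulr_natl.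
have [->|J0] := posnP #|J|; first by rewrite muln0.
have J0' : (0 : R) < #|J|%:R by rewrite ltr0n.
rewrite expr2 -(ler_nat R) !natrM => h.
rewrite -(ler_pM2l J0'); lra.
Qed.
End DualSieve.

(** * Sets of speeds of low rank *)

Lemma ex_avoid (T I : finType) (A : {set T}) (B : I -> {set T}) :
  (\sum_i #|B i| < #|A|)%N -> exists2 a, a \in A & forall i, a \notin B i.
Proof.
move=> BA; have [a /andP[aA /forallP aB]|noA] := pickP (fun a => (a \in A) && [forall i, a \notin B i]).
  by exists a.
move: BA; rewrite ltnNge -sum1_card => /negP[].
rewrite (eq_bigr (fun i => \sum_(a in A | a \in B i) 1 + \sum_(a in B i :\: A) 1)%N); last first.
  move=> i _; rewrite -sum1_card (bigID (mem A))/=; congr addn.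
    by apply: eq_bigl => a; rewrite andbC.
  by apply: eq_bigl => a; rewrite inE andbC.
rewrite big_split /= (leq_trans _ (leq_addr _ _))//.
rewrite (exchange_big_dep (mem A))/=; last by move=> i a _ /andP[].
apply: leq_sum => a aA; have := noA a; rewrite aA/= => /negbT; rewrite negb_forall.
move=> /existsP[i]; rewrite negbK => aB.
by rewrite (bigD1 i) ?aA//= leq_addr.
Qed.

Section LowRank.
Variables (R : realType) (I : finType) (v : I -> nat) (S : {set I}).
Variables (r M : nat) (c : I -> nat) (e : I -> I -> int).
Hypothesis v_gt0 : forall i, (0 < v i)%N.
Hypothesis c_gt0 : forall i, (0 < c i)%N.
Hypothesis e_le : forall i j, (`|e i j|%N <= r)%N.
Hypothesis relE : forall i, (c i * v i)%:Z = \sum_(j in S) e i j * (v j)%:Z.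
Hypothesis M_gt0 : (0 < M)%N.
Hypothesis M_ge : (#|S| * r * 2 <= M)%N.
Let d := #|S|.
Let n := #|I|.

(* Dirichlet's theorem yields more candidates for [t0] than are lost by asking
   that no [\sum_(j in S) e i j * w j] be too small. *)
Lemma ex_lift_speeds : (0 < n)%N -> exists (t0 : R) (w : I -> R),
  [/\ forall j, j \in S -> `|w j| < M%:R^-1,
      forall i, exists k : int, t0 * (c i * v i)%:R = \sum_(j in S) (e i j)%:~R * w j + k%:~R &
      forall i, 2 <= (16 * n * M ^ d)%:R * `|\sum_(j in S) (e i j)%:~R * w j| ].
Proof.
(* With [q = L %/ D], Dirichlet retains at least [L / M^d >= 4nq] values of [a], whereas each of the
   [n] sets to be avoided has fewer than [2q] elements. *)
move=> n0; pose D := (4 * n * M ^ d)%N.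
have D0 : (0 < D)%N by rewrite !muln_gt0 n0 expn_gt0 M_gt0.
(* A prime exceeding every [c i * v i] is coprime to them all; exceeding [D] as well, it satisfies
   [L <= 2Dq]. *)
have [L LZ L_pr] := prime_above (2 * D + \max_i (c i * v i)).
have L0 := prime_gt0 L_pr; have L0R : (0 : R) < L%:R by rewrite ltr0n.
have LN0 : (L%:R : R) != 0 by rewrite gt_eqF.
have coL i : coprime L (c i * v i).
  rewrite prime_coprime//; apply/negP => /dvdn_leq; rewrite muln_gt0 c_gt0 v_gt0 => /(_ isT).
  apply/negP; rewrite -ltnNge (leq_ltn_trans _ LZ)// (leq_trans _ (leq_addl _ _))//.
  exact: (leq_bigmax (F := fun i => c i * v i)%N).
pose q := (L %/ D)%N.
have q_le : (q * D <= L)%N by rewrite leq_divM.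
have q_ge : (L <= 2 * D * q)%N.
  have := ltn_ceil L D0; rewrite -/q; have : (0 < q)%N by rewrite divn_gt0//; lia.
  by move=> ? ?; nia.
have [a0] := dirichlet (fun j : {j | j \in S} => (v (val j))%:R / L%:R : R) L0 M_gt0.
set A := [set _ | _]; rewrite card_sig -/d => LA.
pose B i := [set b : 'I_L | (dist_int ((b%:R - a0%:R) * (c i * v i)%:R / L%:R : R) < q%:R / L%:R)%R].
have BA : (\sum_i #|B i| < #|A|)%N.
  apply: (@leq_ltn_trans (n * (2 * q))).
    rewrite -sum_nat_const; apply: leq_sum => i _.
    apply: leq_trans (card_dist_int_mul_lt R q a0 L0 (coL i)) _.
    by rewrite -mul2n leq_pred.
  rewrite -(ltn_pmul2l (_ : 0 < M ^ d)%N) ?expn_gt0 ?M_gt0//.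
  apply: leq_trans LA; move: q_le; rewrite /D; nia.
have [a aA aB] := ex_avoid BA.
pose t0 : R := (a%:R - a0%:R) / L%:R.
have w_ex j : exists x : R, j \in S -> `|x| < M%:R^-1 /\ exists k : int, t0 * (v j)%:R = x + k%:~R.
  have [jS|] := boolP (j \in S); last by exists 0.
  move: aA; rewrite inE => /forallP /(_ (exist _ j jS)) /= /dist_int_lt[k jk].
  exists (t0 * (v j)%:R - k%:~R) => _; split; last by exists k; rewrite subrK.
  by move: jk; rewrite mulrA mulrAC.
have [w wP] := choice w_ex.
exists t0, w; have zE i : exists k : int, t0 * (c i * v i)%:R = \sum_(j in S) (e i j)%:~R * w j + k%:~R.
  have k_ex j : exists k : int, j \in S -> t0 * (v j)%:R = w j + k%:~R.
    by have [jS|] := boolP (j \in S); [have [_ [k kE]] := wP j jS; exists k | exists 0].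
  have [k kP] := choice k_ex.
  exists (\sum_(j in S) e i j * k j).
  rewrite -[(c i * v i)%:R]/((c i * v i)%:Z%:~R) relE !raddf_sum/= mulr_sumr -big_split/=.
  apply: eq_bigr => j jS; rewrite !intrM mulrCA -pmulrn kP// mulrDr.
  by [].
split=> // [j jS|i]; first by have [] := wP j jS.
have [k kE] := zE i; have := aB i; rewrite inE -leNgt.
rewrite mulrAC -/t0 kE dist_int_period => /le_trans/(_ (dist_int_norm _)) h.
rewrite (le_trans _ (ler_wpM2l _ h))// mulrA ler_pdivlMr//.
rewrite -!natrM ler_nat; move: q_ge; rewrite /D; nia.
Qed.

Lemma rel_comb_le (x : I -> R) i : (forall j, j \in S -> `|x j| < M%:R^-1) ->
  `|\sum_(j in S) (e i j)%:~R * x j| <= d%:R * r%:R / M%:R.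
Proof.
move=> xM; apply: le_trans (ler_norm_sum _ _ _) _.
rewrite -mulrA mulr_natl -sumr_const; apply: ler_sum => j jS.
rewrite normrM ler_pM ?(ltW (xM j jS))// -intr_norm -natr_absz.
by rewrite ler_nat e_le.
Qed.

(* The speeds [v i] behave like [y i / c i]; the multiple [Q] of all the [c i]
   clears these denominators. *)
Lemma ex_integer_model : (0 < n)%N -> exists y : I -> int,
  [/\ forall i, y i != 0,
      forall i, (`|y i| <= 16 * n * (M ^ d * M ^ d))%N &
      forall Q p a : nat, (forall i, (c i %| Q)%N) -> (0 < p)%N -> (a <= p)%N ->
        exists t : R, forall i,
          dist_int ((Q %/ c i)%:R * a%:R * (y i)%:~R / p%:R : R) <=
          dist_int (t * (v i)%:R) + Q%:R * (2 * (d%:R * r%:R / M%:R))].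
Proof.
move=> n0; have [t0 [w [wM zE z_ge]]] := ex_lift_speeds n0.
pose z i := \sum_(j in S) (e i j)%:~R * w j; set N0 := (16 * n * M ^ d)%N in z_ge.
set E : R := d%:R * r%:R / M%:R.
have M0 : (0 : R) < M%:R by rewrite ltr0n.
have E12 : E <= 2^-1.
  have : d%:R * r%:R * 2 <= M%:R :> R by rewrite -!natrM ler_nat.
  by rewrite /E ler_pdivrMr//; lra.
have E0 : 0 <= E by rewrite /E divr_ge0// ltW.
have z_le i : `|z i| <= E by apply: rel_comb_le.
(* Second use of Dirichlet: among [M^d + 1] multiples of [N0] two share a cube, and their difference
   [N1] brings every [N1 * w j] close to an integer. *)
have [a0] := dirichlet (fun j : {j | j \in S} => N0%:R * w (val j)) (ltn0Sn (M ^ d)) M_gt0.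
set A := [set _ | _]; rewrite card_sig -/d => LA.
have A1 : (1 < #|A|)%N.
  rewrite ltnNge; apply: contraL LA => A1; rewrite -ltnNge ltnS.
  by rewrite -[leqRHS]muln1 leq_mul2l A1 orbT.
have [a aA aa0] : exists2 a, a \in A & a != a0.
  have [a /andP[aA aa0]|noA] := pickP (fun a => (a \in A) && (a != a0)); first by exists a.
  move: A1; rewrite ltnNge -(cards1 a0) subset_leq_card//.
  by apply/fintype.subsetP => a aA; rewrite inE; have := noA a; rewrite aA => /negbFE.
pose N1 : int := (a%:Z - a0%:Z) * N0%:Z.
have k_ex j : exists k : int, j \in S -> `|N1%:~R * w j - k%:~R| < M%:R^-1.
  have [jS|] := boolP (j \in S); last by exists 0.
  move: aA; rewrite inE => /forallP /(_ (exist _ j jS)) /= /dist_int_lt[k jk].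
  by exists k => _; rewrite /N1 intrM intrB -mulrA.
have [k kP] := choice k_ex.
(* This lies within [E <= 1/2] of [N1 * z i], whose absolute value is at least 2; hence [y i] is
   nonzero. *)
pose y i := \sum_(j in S) e i j * k j.
have y_near i : `|N1%:~R * z i - (y i)%:~R| <= E.
  have -> : N1%:~R * z i - (y i)%:~R = \sum_(j in S) (e i j)%:~R * (N1%:~R * w j - (k j)%:~R).
    rewrite /y raddf_sum mulr_sumr -sumrB; apply: eq_bigr => j _ /=.
    by rewrite intrM mulrBr mulrCA.
  by apply: rel_comb_le.
have N1z i : 2 <= `|N1%:~R * z i|.
  rewrite normrM /N1 intrM normrM -mulrA (le_trans (z_ge i))//.
  rewrite -[X in X * (_ * _)]intr_norm [X in _ * (X * _)]ger0_norm// ler_peMl ?mulr_ge0//.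
  rewrite -[1]/(1%:~R) ler_int; move: aa0; rewrite -val_eqE /=; lia.
exists y; split.
- move=> i; apply/eqP => y0; have := y_near i; rewrite y0 subr0 => h.
  by have := N1z i; lra.
- move=> i; rewrite -(ler_nat R).
  have -> : `|y i|%:R = `|(y i)%:~R| :> R by rewrite -intr_norm natr_absz.
  have -> : (y i)%:~R = N1%:~R * z i - (N1%:~R * z i - (y i)%:~R) by rewrite opprB addrCA subrr addr0.
  rewrite (le_trans (ler_normB _ _))//.
  have N1_le : `|N1%:~R : R| <= (16 * n * (M ^ d * M ^ d))%:R.
    rewrite -intr_norm -[leRHS]/(_%:Z%:~R) ler_int /N1 normrM.
    have : `|a%:Z - a0%:Z| <= (M ^ d)%:Z.
      by have := ltn_ord a; have := ltn_ord a0; rewrite !ltnS; lia.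
    rewrite (ger0_norm (x := N0%:Z))// => h; apply: le_trans (ler_wpM2r _ h) _ => //.
    by rewrite /N0; lia.
  have K1 : (1 : R) <= (16 * n * (M ^ d * M ^ d))%:R.
    by rewrite ler1n !muln_gt0 n0 expn_gt0 M_gt0.
  have := y_near i; have := z_le i; rewrite normrM.
  move: (`|z i|) (normr_ge0 (z i)) => u u0 uE yE.
  have : `|N1%:~R| * u <= (16 * n * (M ^ d * M ^ d))%:R * 2^-1.
    by rewrite ler_pM// (le_trans uE).
  by lra.
move=> Q p a' cQ p0 ap.
have p0R : (0 : R) < p%:R by rewrite ltr0n.
(* Modulo 1, [t * v i] becomes [(Q / c i) * x * z i]. Rounding [N1 * a' / p] to [x] and replacing
   [N1 * z i] by [y i] each cost at most [E], before the factor [Q / c i]. *)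
pose x := Num.floor (N1%:~R * a'%:R / p%:R : R).
exists (Q%:R * x%:~R * t0) => i.
have [l tE] := zE i.
have cN0 : (c i)%:R != 0 :> R by rewrite pnatr_eq0 -lt0n.
have -> : Q%:R * x%:~R * t0 * (v i)%:R =
    (Q %/ c i)%:R * (x%:~R * z i) + ((Q %/ c i)%:Z * x * l)%:~R.
  rewrite -{1}(divnK (cQ i)) natrM 2!intrM -!pmulrn.
  have -> : (Q %/ c i)%:R * (c i)%:R * x%:~R * t0 * (v i)%:R =
     (Q %/ c i)%:R * x%:~R * (t0 * (c i * v i)%:R) by rewrite natrM; ring.
  by rewrite tE -/(z i); ring.
rewrite dist_int_period (le_trans (dist_int_lip _ ((Q %/ c i)%:R * (x%:~R * z i))))//.
rewrite lerD2l -!mulrA -mulrBr normrM [X in X * _]ger0_norm//.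
rewrite ler_pM// ?ler_nat ?leq_div//.
pose f : R := N1%:~R * a'%:R / p%:R - x%:~R.
have f01 : `|f| <= 1.
  have := floor_itv (N1%:~R * a'%:R / p%:R : R); rewrite -/x intrD /f => /andP[? ?].
  by rewrite ger0_norm; lra.
have -> : a'%:R * ((y i)%:~R / p%:R) - x%:~R * z i =
   f * z i - (a'%:R / p%:R) * (N1%:~R * z i - (y i)%:~R).
  by rewrite /f; ring.
rewrite [leRHS](_ : _ = E + E); last by rewrite /E; ring.
rewrite (le_trans (ler_normB _ _))// lerD// normrM.
  by rewrite -[leRHS]mul1r ler_pM// -/E.
rewrite -[leRHS]mul1r ler_pM// ger0_norm ?divr_ge0//.
by rewrite ler_pdivrMr// mul1r ler_nat.
Qed.

End LowRank.

(** Besides [a = 0], each [i] excludes at most [2j] residues, so the [p - 1] nonzero residues are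
    not exhausted. *)
Lemma ex_lonely_residue (R : realType) (I : finType) (p j : nat) (W : I -> int) :
    prime p -> (forall i, ~~ (p %| `|W i|)%N) -> (#|I| * j.*2 < p.-1)%N ->
  exists2 a : nat, (a < p)%N & forall i, j.+1%:R / p%:R <= dist_int (a%:R * (W i)%:~R / p%:R : R).
Proof.
move=> p_pr Wp jp; have p0 := prime_gt0 p_pr; pose o : 'I_p := Ordinal p0.
pose C i := [set b : 'I_p | (dist_int ((b%:R - 0%:R) * `|W i|%:R / p%:R : R) < j.+1%:R / p%:R)%R].
have [a aN0 aC] : exists2 a, a \in [set~ o] & forall i, a \notin C i :\ o.
  apply: ex_avoid; apply: (@leq_ltn_trans (\sum_(i : I) j.*2)).
    apply: leq_sum => i _.
    have Co : o \in C i.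
      by rewrite inE /= subrr !mul0r (le_lt_trans (dist_int_norm _))// normr0 divr_gt0// ltr0n.
    have := @card_dist_int_mul_lt R p j.+1 `|W i| 0 p0.
    by rewrite prime_coprime// Wp => /(_ isT); rewrite -/(C i) (cardsD1 o) Co doubleS.
  by rewrite sum_nat_const cardsC1 card_ord.
exists a => // i; move: aN0 (aC i); rewrite !inE => -> /=; rewrite -leNgt subr0.
move=> /le_trans; apply; rewrite natr_absz intr_norm le_eqVlt; apply/orP; left; apply/eqP.
have [W0|W0] := leP 0 (W i); first by rewrite ger0_norm ?ler0z.
by rewrite ler0_norm ?lerz0 1?ltW// mulrN mulNr dist_intN.
Qed.

(** The gain governed by [s] comes from the position of the prime modulo [2n]; the subtracted term
    is the price of replacing [v i] by [y i / c i]. [B] and [l] bound the binary logarithms of the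
    product to which [p] must be coprime and of the range [2nJ] of primes. *)
Lemma low_rank_lonely (R : realType) (I : finType) (v : I -> nat) (S : {set I})
    (r M : nat) (c : I -> nat) (e : I -> I -> int) (s J l B : nat) :
    (0 < #|I|)%N -> (forall i, 0 < v i)%N -> (forall i, 0 < c i <= r)%N ->
    (forall i j, `|e i j|%N <= r)%N ->
    (forall i, (c i * v i)%:Z = \sum_(j in S) e i j * (v j)%:Z) ->
    (0 < M)%N -> (#|S| * r * 2 <= M)%N -> (0 < s)%N ->
    (r`! * (16 * #|I| * (M ^ #|S| * M ^ #|S|)) ^ #|I| <= 2 ^ B)%N ->
    (0 < J)%N -> (#|I|.*2 * J <= 2 ^ l)%N ->
    (l * (B + J * s).+1 < #|I|.*2 * J)%N ->
  exists t : R, forall i,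
    1 / (2 * #|I|%:R) + (s%:R - 1) / (2 * #|I|%:R * (#|I|.*2 * J)%:R)
      - r`!%:R * (2 * (#|S|%:R * r%:R / M%:R)) <= dist_int (t * (v i)%:R).
Proof.
set n := #|I|; set d := #|S|.
move=> n0 v_gt0 c_r e_le relE M0 M_ge s0 YB J0 Xl lX.
have c_gt0 i : (0 < c i)%N by have /andP[] := c_r i.
have [y [yN0 y_le lift]] := @ex_integer_model R I v S r M c e v_gt0 c_gt0 e_le relE M0 M_ge n0.
(* The factorial of [r] is a common multiple of the [c i], so a prime not dividing [Y] divides none
   of the speeds once their denominators are cleared. *)
pose Y := (r`! * \prod_i `|y i|)%N.
have Y0 : (0 < Y)%N.
  by rewrite muln_gt0 fact_gt0 prodn_gt0// => i; rewrite absz_gt0.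
have YB' : (Y <= 2 ^ B)%N.
  apply: leq_trans YB; rewrite leq_mul2l -prod_nat_const; apply/orP; right.
  by apply: leq_prod.
have [p [p_pr pX pY rho]] := ex_good_prime n0 J0 Y0 YB' Xl lX.
have p0 := prime_gt0 p_pr; have p1 := prime_gt1 p_pr.
have cQ i : (c i %| r`!)%N by apply: dvdn_fact.
(* A point [(j + 1) / p] gains over [1 / 2n] because [2n (j + 1)] exceeds
   [p - 1] by at least [s]. *)
pose j := ((p - 2) %/ n.*2)%N.
have pE : (p - 2 = j * n.*2 + (p - 2) %% n.*2)%N by exact: divn_eq.
pose W i : int := (r`! %/ c i)%:Z * y i.
have Wp i : ~~ (p %| `|W i|)%N.
  apply: contra pY; rewrite abszM absz_nat Euclid_dvdM// => /orP[h|h].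
    by rewrite dvdn_mulr// -(divnK (cQ i)) dvdn_mulr.
  by rewrite dvdn_mull// (bigD1 i)//= dvdn_mulr.
have [|a ap aW] := @ex_lonely_residue R I p j W p_pr Wp; first by rewrite -/n; lia.
have [t tP] := lift r`! p a cQ p0 (ltnW ap).
exists t => i; rewrite lerBlDr; apply: le_trans (tP i).
apply: le_trans (_ : j.+1%:R / p%:R <= _); last first.
  apply: le_trans (aW i) _; rewrite /W intrM -pmulrn.
  by rewrite [a%:R * _]mulrCA mulrA.
have p0R : (0 : R) < p%:R by rewrite ltr0n.
have n0R : (0 : R) < n%:R by rewrite ltr0n.
have s1 : 0 <= (s%:R - 1 : R) by rewrite subr_ge0 ler1n.
have jn : p%:R + (s%:R - 1) <= 2 * n%:R * j.+1%:R :> R.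
  have : (p + s <= 2 * n * j.+1 + 1)%N by move: rho pE; move: (_ %% _)%N => rho; nia.
  by rewrite -(ler_nat R) !natrD !natrM; lra.
apply: (@le_trans _ _ ((p%:R + (s%:R - 1)) / (2 * n%:R * p%:R))); last first.
  rewrite ler_pdivrMr ?mulr_gt0//.
  rewrite [leRHS](_ : _ = 2 * n%:R * j.+1%:R)//; field.
  by rewrite gt_eqF.
rewrite [leRHS]mulrDl lerD//.
  rewrite le_eqVlt; apply/orP; left; apply/eqP; field.
  by rewrite !gt_eqF.
rewrite ler_wpM2l// lef_pV2 ?posrE ?mulr_gt0 ?ltr0n ?muln_gt0 ?double_gt0 ?n0//.
by rewrite ler_pM2l ?mulr_gt0// ler_nat.
Qed.

(** * Dissociated sets of speeds *)

Definition dissociated (I : finType) (v : I -> nat) (r : nat) (S : {set I}) :=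
  forall c : I -> int, (forall i, `|c i|%N <= r)%N ->
    \sum_(i in S) c i * (v i)%:Z = 0 -> forall i, i \in S -> c i = 0.

Section Dissociated.
Variables (I : finType) (v : I -> nat) (r : nat).

Lemma dissociated_sub (S T : {set I}) :
  T \subset S -> dissociated v r S -> dissociated v r T.
Proof.
move=> /fintype.subsetP TS disS c c_le cT i iT.
pose c' j := if j \in T then c j else 0.
have -> : c i = c' i by rewrite /c' iT.
apply: disS (TS _ iT) => [j|]; first by rewrite /c'; case: ifP.
rewrite (big_setID T)/= [X in _ + X]big1 ?addr0; last first.
  by move=> j; rewrite inE /c' => /andP[/negbTE ->]; rewrite mul0r.
rewrite -[RHS]cT; apply: eq_big => j; last by rewrite inE /c' => /andP[_ ->].
by rewrite inE andb_idl// => /TS.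
Qed.

(** Take [S] of largest size. For [i] outside it, adding [i] creates a relation in which [i] has a
    nonzero coefficient, [S] being dissociated; this relation is solved for [v i]. *)
Lemma ex_max_dissociated : (0 < r)%N -> exists S : {set I}, dissociated v r S /\
  forall i, exists (c : nat) (e : I -> int), [/\ (0 < c <= r)%N,
    forall j, (`|e j|%N <= r)%N & (c * v i)%:Z = \sum_(j in S) e j * (v j)%:Z].
Proof.
move=> r0; have dis0 : `[< dissociated v r finset.set0 >].
  by apply/asboolP => c _ _ i; rewrite inE.
have [S /asboolP disS Smax] :=
  arg_maxnP (P := fun S => `[< dissociated v r S >]) (fun S : {set I} => #|S|) dis0.
exists S; split=> // i.
have [iS|iS] := boolP (i \in S).
  exists 1%N, (fun j => (j == i)%:Z); split=> // [j|]; first by case: eqP.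
  rewrite (bigD1 i)//= eqxx mul1r mul1n big1 ?addr0// => j /andP[_ /negbTE ->].
  by rewrite mul0r.
have /asboolP : ~~ `[< dissociated v r (i |: S) >].
  by apply/negP => /Smax; rewrite /= cardsU1 iS add1n ltnn.
move=> /existsNP[c /not_implyP[c_le /not_implyP[cE /existsNP[k /not_implyP[kiS /eqP ck]]]]].
move: cE; rewrite big_setU1//= => cE.
have ci0 : c i != 0.
  apply: contra ck => /eqP ci; move: cE; rewrite ci mul0r add0r => cE.
  move: kiS; rewrite !inE => /orP[/eqP->|kS]; first by rewrite ci.
  by apply/eqP; exact: disS c_le cE _ kS.
(* The sign of [c i] moves to the other side so that the multiplier of [v i] is positive. *)
exists `|c i|%N, (fun j => - sgz (c i) * c j); split=> [|j|].
- by rewrite absz_gt0 ci0 c_le.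
- by rewrite abszM abszN; case: sgzP ci0 => //; rewrite !mul1n.
rewrite PoszM (eq_bigr (fun j => - sgz (c i) * (c j * (v j)%:Z))); last by move=> j _; rewrite mulrA.
rewrite -mulr_sumr; have -> : \sum_(j in S) c j * (v j)%:Z = - (c i * (v i)%:Z).
  by apply/eqP; rewrite -addr_eq0 addrC cE.
by rewrite mulrNN mulrA abszEsg.
Qed.

End Dissociated.

Lemma leq_bin_exp d k : ('C(d, k) <= d ^ k)%N.
Proof.
apply: (@leq_trans (d ^_ k)); first by rewrite -bin_ffact leq_pmulr ?fact_gt0.
elim: k => // k IHk; rewrite ffactnSr expnSr leq_mul//.
exact: leq_subr.
Qed.

(** * Covering multiplicities of Bohr sets modulo [L] *)

Section Sieve.
Variables (R : realType) (I : finType) (v : I -> nat) (r : nat) (delta : R).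
Variable L : nat.
Hypothesis L_gt0 : (0 < L)%N.

Let B i := [set a : 'I_L | (dist_int (a%:R * (v i)%:R / L%:R : R) < delta)%R].

(* The sums [\sum_(i in T) f_i * v_i] with [0 <= f_i <= r] are distinct modulo
   [L], and [a] times such a sum is close to [0] when [a] lies in every [B i]. *)
Lemma card_dissociated_bohr (T : {set I}) :
    dissociated v r T -> (r * \sum_(i in T) v i < L)%N ->
    0 < delta -> #|T|%:R * r%:R * delta < 8^-1 ->
  (#|[set a | [forall i in T, a \in B i]]| * r.+1 ^ #|T| <= 4 * L)%N.
Proof.
move=> disT rL delta0 small.
pose g (f : {ffun 'I_#|T| -> 'I_r.+1}) := (\sum_x f x * v (enum_val x))%N.
have g_lt f : (g f < L)%N.
  apply: leq_ltn_trans rL; rewrite big_enum_val big_distrr /=.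
  by apply: leq_sum => x _; rewrite leq_mul2r -ltnS ltn_ord orbT.
have -> : (r.+1 ^ #|T| = #|{ffun 'I_#|T| -> 'I_r.+1}|)%N by rewrite card_ffun !card_ord.
apply: (@dual_sieve R L _ g) => // [f h|a f].
  rewrite !modn_small// => gfh; apply/ffunP => x.
  (* The difference of [f] and [h], carried from the enumeration of [T] to [I] and extended by 0, is
     a relation with coefficients at most [r]. *)
  pose c i : int := if [pick y | enum_val y == i] is Some y then (f y)%:Z - (h y)%:Z else 0.
  have cE y : c (enum_val y) = (f y)%:Z - (h y)%:Z.
    rewrite /c; case: pickP => [z /eqP/enum_val_inj->//|/(_ y)].
    by rewrite eqxx.
  have : c (enum_val x) = 0.
    apply: disT; last exact: enum_valP.
      move=> i; rewrite /c; case: pickP => [y _|//].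
      by have := ltn_ord (f y); have := ltn_ord (h y); lia.
    rewrite big_enum_val (eq_bigr (fun y => (f y * v (enum_val y))%:Z - (h y * v (enum_val y))%:Z)).
      by rewrite sumrB -!(raddf_sum Posz) -/(g f) -/(g h) gfh subrr.
    by move=> y _; rewrite cE mulrBl !PoszM.
  by rewrite cE => /eqP; rewrite subr_eq0 => /eqP[] /val_inj.
rewrite inE => /forall_inP aB; apply: le_lt_trans small.
have -> : a%:R * (g f)%:R / L%:R =
    \sum_x (f x)%:R * (a%:R * (v (enum_val x))%:R / L%:R) :> R.
  rewrite /g natr_sum mulr_sumr mulr_suml; apply: eq_bigr => x _.
  by rewrite natrM; ring.
apply: le_trans (dist_int_sum _ _) _.
rewrite [leRHS](_ : _ = \sum_(x < #|T|) (r%:R * delta)); last first.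
  by rewrite sumr_const card_ord -[RHS]mulr_natl mulrA.
apply: ler_sum => x _.
apply: le_trans (dist_int_natM _ _) _; rewrite ler_pM ?dist_int_ge0//.
  by rewrite ler_nat -ltnS ltn_ord.
by have := aB _ (enum_valP x); rewrite inE => /ltW.
Qed.

(* Differences of two elements of the same box of side [1 / N]. *)
Lemma card_pair_bohr (N : nat) i k : (0 < N)%N -> N%:R^-1 <= delta ->
  (L <= N ^ 2 * #|B i :&: B k|)%N.
Proof.
move=> N0 Nd; pose th (b : bool) : R := (v (if b then i else k))%:R / L%:R.
have [a0] := dirichlet th L_gt0 N0; rewrite card_bool => /leq_trans; apply.
rewrite leq_mul2l; apply/orP; right.
(* Subtracting [a0] modulo [L] injects the cube of [a0] into the intersection. *)
have sL (a : 'I_L) : ((a + (L - a0)) %% L < L)%N by rewrite ltn_mod.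
pose s a := Ordinal (sL a).
have sE a (b : bool) : dist_int ((s a)%:R * (v (if b then i else k))%:R / L%:R) =
    dist_int ((a%:R - a0%:R) * th b).
  have LN0 : (L%:R : R) != 0 by rewrite pnatr_eq0 -lt0n.
  rewrite /s /= -mulrA -/(th b) -[RHS](dist_int_period _ (v (if b then i else k))%:Z).
  have := divn_eq (a + (L - a0)) L; move: (_ %% _)%N (_ %/ _)%N => x q.
  move=> /(congr1 (fun u => u%:R : R)); rewrite !natrD natrB ?natrM; last exact: ltnW.
  move=> xE; rewrite -[LHS](dist_int_period _ (q * v (if b then i else k))%:Z).
  congr dist_int; rewrite -!pmulrn natrM /th.
  have -> : x%:R = a%:R + (L%:R - a0%:R) - q%:R * L%:R :> R by rewrite xE; ring.
  by field.
have s_inj : injective s.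
  move=> a b /(congr1 (@nat_of_ord _)) /= /eqP; rewrite eqn_modDr !modn_small//.
  by move=> /eqP/val_inj.
rewrite -(card_imset _ s_inj); apply/subset_leq_card/fintype.subsetP.
move=> _ /imsetP[a + ->]; rewrite !inE => /forallP aP.
have := aP true; have := aP false; rewrite -!sE /= => h1 h2.
by rewrite (lt_le_trans h1 Nd) (lt_le_trans h2 Nd).
Qed.

Hypothesis L_coprime : forall i, coprime L (v i).

Lemma card_bohr_le i : 0 < delta -> #|B i|%:R <= 2 * delta * L%:R + 1 :> R.
Proof.
move=> d0; have L0 : (0 : R) < L%:R by rewrite ltr0n.
have dL0 : 0 <= delta * L%:R by rewrite mulr_ge0// ltW.
pose q := Num.truncn (delta * L%:R).
have /andP[q1 q2] := truncn_itv dL0; rewrite -/q in q1 q2.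
have : (#|B i| <= q.+1.*2.-1)%N.
  apply: leq_trans (card_dist_int_mul_lt R q.+1 0 L_gt0 (L_coprime i)).
  apply/subset_leq_card/fintype.subsetP => a; rewrite !inE subr0 => /lt_trans; apply.
  by rewrite ltr_pdivlMr.
rewrite doubleS /= -(ler_nat R) => /le_trans; apply.
by rewrite -addn1 natrD -muln2 natrM; lra.
Qed.

Lemma dissociated_count (S : {set I}) (N tau : nat) :
    (forall a : 'I_L, exists i, a \in B i) ->
    dissociated v r S -> (r * \sum_i v i < L)%N -> 0 < delta ->
    (0 < N)%N -> N%:R^-1 <= delta ->
    tau%:R * r%:R * delta < 8^-1 ->
  (#|S| * #|I|.-1 * L)%:R / (N ^ 2)%:R <=
    tau%:R * (#|I|%:R * (2 * delta * L%:R + 1) - L%:R) +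
    (#|S| * #|I| * #|S| ^ tau * (4 * L))%:R / (r.+1 ^ tau)%:R :> R.
Proof.
move=> cov disS rL d0 N0 Nd small; set n := #|I|; set d := #|S|.
(* Double count [\sum_a G a * (F a - 1)], where [F] and [G] are the covering
   multiplicities of the [B i] for all [i] and for [i] in [S] respectively. *)
pose F a := (\sum_i (a \in B i))%N; pose G a := (\sum_(i in S) (a \in B i))%N.
have F_gt0 a : (0 < F a)%N by have [i ai] := cov a; rewrite /F (bigD1 i)//= ai.
pose U := [set a | (tau <= G a)%N].
have sum_mem i : (\sum_a (a \in B i) = #|B i|)%N.
  by rewrite -sum1_card [RHS]big_mkcond; apply: eq_bigr => a _; case: (a \in _).
have sumF : (\sum_a F a = \sum_i #|B i|)%N.
  by rewrite exchange_big; apply: eq_bigr => i _; exact: sum_mem.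
have sumF1 : (\sum_a (F a).-1 + L = \sum_i #|B i|)%N.
  rewrite -sumF -[X in (_ + X)%N]card_ord -sum1_card -big_split /=.
  by apply: eq_bigr => a _; rewrite addn1 prednK.
(* For [a] in [B i], [F a - 1] counts the other [k] with [a] in [B k], so the sum runs over pairwise
   intersections. *)
have lower : (d * n.-1 * L <= N ^ 2 * \sum_a G a * (F a).-1)%N.
  have -> : (\sum_a G a * (F a).-1 = \sum_(i in S) \sum_(k | k != i) #|B i :&: B k|)%N.
    rewrite (eq_bigr (fun a => \sum_(i in S) \sum_(k | k != i) (a \in B i :&: B k))%N).
      rewrite exchange_big; apply: eq_bigr => i _; rewrite exchange_big; apply: eq_bigr => k _.
      by rewrite -sum1_card [RHS]big_mkcond; apply: eq_bigr => a _; case: (a \in _).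
    move=> a _; rewrite /G big_distrl /=; apply: eq_bigr => i _.
    case: (boolP (a \in B i)) => ai; last first.
      by rewrite mul0n big1// => k _; rewrite finset.in_setI (negbTE ai).
    rewrite mul1n /F (bigD1 i)//= ai add1n /=; apply: eq_bigr => k _.
    by rewrite finset.in_setI ai.
  rewrite -mulnA -sum_nat_const big_distrr /=; apply: leq_sum => i _.
  have -> : n.-1 = #|[set~ i]| by rewrite cardsC1.
  rewrite -sum_nat_const big_distrr /= [leqRHS](eq_bigl (fun k => k \in [set~ i])).
    by apply: leq_sum => k _; exact: card_pair_bohr.
  by move=> k; rewrite !inE.
have G_le a : (G a <= d)%N.
  by rewrite /d -sum1_card; apply: leq_sum => i _; case: (_ \in _).
have F_le a : (F a <= n)%N.
  by rewrite /n -sum1_card; apply: leq_sum => i _; case: (_ \in _).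
have upper : (\sum_a G a * (F a).-1 <= tau * \sum_a (F a).-1 + d * n * #|U|)%N.
  rewrite -[#|U|]sum1_card !big_distrr [X in (_ + X)%N]big_mkcond -big_split /=.
  apply: leq_sum => a _; rewrite inE; case: (leqP tau (G a)) => Ga.
    by rewrite muln1 (leq_trans _ (leq_addl _ _))// leq_mul// (leq_trans (leq_pred _)).
  by rewrite addn0 leq_mul2r ltnW ?orbT.
(* A point of [U] lies in every [B i] of some [tau]-element subset of [S]; there are at most
   [d ^ tau] such subsets. *)
have U_le : (#|U| * r.+1 ^ tau <= d ^ tau * (4 * L))%N.
  pose DT := [set T : {set I} | (T \subset S) && (#|T| == tau)].
  pose A (T : {set I}) := [set a | [forall i in T, a \in B i]].
  have UA : (#|U| <= \sum_(T in DT) #|A T|)%N.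
    rewrite -[leqLHS]sum1_card.
    rewrite [leqRHS](eq_bigr (fun T => \sum_a (a \in A T))%N); last first.
      by move=> T _; rewrite -sum1_card big_mkcond; apply: eq_bigr => a _; case: (_ \in _).
    rewrite exchange_big [leqLHS]big_mkcond /=; apply: leq_sum => a _.
    rewrite inE; case: (leqP tau (G a)) => // Ga.
    pose Sa := [set i in S | a \in B i].
    have Sa_card : #|Sa| = G a.
      rewrite -sum1_card /G big_mkcond [RHS]big_mkcond; apply: eq_bigr => i _.
      by rewrite inE; case: (i \in S); case: (_ \in _).
    have : (0 < #|[set T : {set I} | (T \subset Sa) && (#|T| == tau)]|)%N.
      by rewrite cards_draws bin_gt0 Sa_card.
    case/card_gt0P => T; rewrite inE => /andP[/fintype.subsetP TSa Ttau].
    rewrite (bigD1 T) /=; last first.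
      rewrite inE Ttau andbT; apply/fintype.subsetP => i /TSa.
      by rewrite inE => /andP[].
    rewrite (_ : a \in A T)//; rewrite inE; apply/forall_inP => i /TSa.
    by rewrite inE => /andP[].
  apply: leq_trans (leq_mul UA (leqnn _)) _; rewrite big_distrl /=.
  apply: (@leq_trans (\sum_(T in DT) 4 * L)).
    apply: leq_sum => T; rewrite inE => /andP[TS /eqP Ttau]; rewrite -Ttau.
    apply: card_dissociated_bohr => //; [exact: dissociated_sub disS| |by rewrite Ttau].
    by apply: leq_ltn_trans rL; rewrite leq_mul2l [leqRHS](bigID (mem T))/= leq_addr orbT.
  by rewrite sum_nat_const cards_draws leq_mul2r leq_bin_exp orbT.
have N0R : (0 : R) < (N ^ 2)%:R by rewrite ltr0n expn_gt0 N0.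
have r0R : (0 : R) < (r.+1 ^ tau)%:R by rewrite ltr0n expn_gt0.
rewrite ler_pdivrMr// mulrC.
apply: (@le_trans _ _ ((N ^ 2)%:R * (tau%:R * (\sum_a (F a).-1)%:R + (d * n)%:R * #|U|%:R))).
  by rewrite -!natrM -natrD -natrM ler_nat (leq_trans lower)// leq_mul2l upper orbT.
rewrite ler_wpM2l//.
rewrite lerD//.
  rewrite ler_wpM2l// lerBrDr -natrD sumF1.
  rewrite raddf_sum /= mulr_natl -sumr_const; apply: ler_sum => i _.
  exact: card_bohr_le.
rewrite ler_pdivlMr// -mulrA -!natrM ler_nat -!mulnA leq_mul2l leq_mul2l U_le !orbT//.
Qed.

End Sieve.

(** * Choice of parameters *)

(** With [u = m %/ (b+1)], [m <= (b+1) (u+1) <= (b+1) 2^u]. Raised to the power [b+1], this leaves a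
    spare factor [m] to absorb [a (b+1)^(b+1)]. *)
Lemma leq_poly_exp2 a b m : (a * b.+1 ^ b.+1 <= m)%N -> (a * m ^ b <= 2 ^ m)%N.
Proof.
move=> am; pose u := (m %/ b.+1)%N.
have b0 : (0 < b.+1 ^ b.+1)%N by rewrite expn_gt0.
rewrite -(leq_pmul2l b0) mulnA [(_ * a)%N]mulnC.
apply: (@leq_trans (m ^ b.+1)); first by rewrite [leqRHS]expnS leq_mul2r am orbT.
apply: (@leq_trans ((b.+1 * u.+1) ^ b.+1)).
  by rewrite leq_exp2r// mulnC ltnW// ltn_ceil.
rewrite expnMn leq_mul2l; apply/orP; right.
apply: (@leq_trans ((2 ^ u) ^ b.+1)); first by rewrite leq_exp2r// ltn_expl.
by rewrite -expnM leq_exp2l// leq_divM.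
Qed.

Lemma leq_fact_exp n : (n`! <= n ^ n)%N.
Proof.
rewrite fact_prod -[X in (n ^ X)%N](card_ord n) -prod_nat_const big_add1 big_mkord.
by apply: leq_prod => i _.
Qed.

(** Up to constants [n] is [m^(3K)], so [r = m^K] is about [n^(1/3)]. If no such [t] exists, the
    Bohr sets cover, and the double count forces [d / (16n) <= 3 tau / P]; but [d P = m^(3K+7)]
    exceeds [48 tau n]. *)
Lemma dissociated_lonely (R : realType) (I : finType) (v : I -> nat) (S : {set I})
    (K m : nat) :
    (0 < K)%N -> (512 * (64 ^ K * K) <= m)%N ->
    (m ^ (3 * K) <= #|I| <= (2 * m) ^ (3 * K))%N ->
    (forall i, 0 < v i)%N -> dissociated v (m ^ K) S -> (m ^ K.-1 <= #|S|)%N ->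
  exists t : R, forall i,
    1 / (2 * #|I|%:R) + 1 / (#|I|%:R * (m ^ (2 * K + 8))%:R) <= dist_int (t * (v i)%:R).
Proof.
set n := #|I|; set P := (m ^ (2 * K + 8))%N.
pose delta : R := 1 / (2 * n%:R) + 1 / (n%:R * P%:R); rewrite -/delta.
move=> K0 m_ge /andP[n_ge n_le] v_gt0 disS S_ge.
apply: contrapT => /forallNP noT.
have cov (t : R) : exists i, dist_int (t * (v i)%:R) < delta.
  have /existsNP[i /negP] := noT t; rewrite -ltNge => ti; by exists i.
have m512 : (512 <= m)%N.
  by apply: leq_trans m_ge; rewrite leq_pmulr// muln_gt0 expn_gt0 K0.
have m0 : (0 < m)%N by lia.
have mX b : (0 < b)%N -> (m <= m ^ b)%N by move=> b0; rewrite -{1}[m]expn1 leq_pexp2l.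
have n512 : (512 <= n)%N.
  by rewrite (leq_trans m512)// (leq_trans _ n_ge)// mX//; lia.
have n0 : (0 < n)%N by lia.
(* As [d / m^K = 1 / m], the exceptional term carries a factor at most [m^(-tau)]; the exponent
   [6K + 1] beats [n^2 <= (2m)^(6K)]. *)
pose tau := (6 * K + 1)%N; pose d := (m ^ K.-1)%N.
have [T [TS Td]] : exists T : {set I}, T \subset S /\ #|T| = d.
  have : (0 < #|[set T : {set I} | (T \subset S) && (#|T| == d)]|)%N.
    by rewrite cards_draws bin_gt0.
  by case/card_gt0P => T; rewrite inE => /andP[TS /eqP Td]; exists T.
have disT := dissociated_sub TS disS.
(* The three summands make the total rounding error [n] at most [L / P], keep the sums of the sieve
   below [L], and make [L] coprime to every [v i]. *)
have [L LZ L_pr] := prime_above (n * P + m ^ K * \sum_i v i + \sum_i v i).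
have L0 := prime_gt0 L_pr.
have coL i : coprime L (v i).
  rewrite prime_coprime//; apply/negP => /dvdn_leq -/(_ (v_gt0 i)); apply/negP.
  by rewrite -ltnNge (leq_ltn_trans _ LZ)// (bigD1 i)//=; lia.
have P0 : (0 < P)%N by rewrite expn_gt0 m0.
have P2 : (2 <= P)%N.
  by rewrite (@leq_trans m) ?mX//; lia.
have mR : (0 : R) < m%:R by rewrite ltr0n.
have nR : (0 : R) < n%:R by rewrite ltr0n.
have PR : (0 : R) < P%:R by rewrite ltr0n.
have LR : (0 : R) < L%:R by rewrite ltr0n.
have delta0 : 0 < delta by rewrite /delta addr_gt0// divr_gt0// mulr_gt0.
have n2delta : 2 * n%:R * delta = 1 + 2 / P%:R.
  by rewrite /delta; field; rewrite !gt_eqF.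
have delta_n : n%:R * delta <= 1.
  have : 2 / P%:R <= 1 :> R by rewrite ler_pdivrMr// mul1r ler_nat.
  by lra.
have Nd : (2 * n)%:R^-1 <= delta.
  by rewrite /delta natrM div1r lerDl divr_ge0// mulr_ge0// ltW.
have Ksmall : (tau <= 7 * K)%N by rewrite /tau; clear - K0; lia.
have tau_m : (8 * (7 * K) < m)%N.
  by apply: leq_trans m_ge; have := expn_gt0 64 K; clear - K0; nia.
have small : tau%:R * (m ^ K)%:R * delta < 8^-1.
  rewrite -(ltr_pM2l nR) mulrCA.
  apply: (@le_lt_trans _ _ (tau%:R * (m ^ K)%:R)).
    by rewrite ler_piMr// mulr_ge0.
  rewrite -[ltRHS]/(_ / _) ltr_pdivlMr// -!natrM ltr_nat.
  apply: leq_trans n_ge; have -> : (3 * K = K + K + K)%N by clear; lia.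
  have mK := mX K K0.
  by rewrite !expnD; clear - mK tau_m Ksmall; nia.
have cov_L (a : 'I_L) :
    exists i, a \in [set b : 'I_L | (dist_int (b%:R * (v i)%:R / L%:R : R) < delta)%R].
  by have [i ti] := cov (a%:R / L%:R); exists i; rewrite inE mulrAC.
have rL : (m ^ K * \sum_i v i < L)%N.
  by rewrite (leq_ltn_trans _ LZ)// -addnA addnCA leq_addr.
have nPL : (n * P <= L)%N by rewrite ltnW// (leq_ltn_trans _ LZ)// -addnA leq_addr.
have N0 : (0 < 2 * n)%N by rewrite muln_gt0.
have count := dissociated_count L0 coL cov_L disT rL delta0 N0 Nd small.
rewrite Td -/n in count.
have d0 : (0 < d)%N by rewrite expn_gt0 m0.
have dR : (0 : R) < d%:R by rewrite ltr0n.
have lo : d%:R * L%:R / (8 * n%:R) <= (d * n.-1 * L)%:R / ((2 * n) ^ 2)%:R :> R.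
  rewrite ler_pdivrMr ?mulr_gt0// mulrAC ler_pdivlMr ?ltr0n ?expn_gt0 ?N0//.
  rewrite -!natrM ler_nat.
  have : (n <= 2 * n.-1)%N by clear - n512; lia.
  move=> /(leq_mul (leqnn (d * L * n * 4))); rewrite !expnS expn0.
  by move: n.-1 => n'; clear; lia.
have hi1 : tau%:R * (n%:R * (2 * delta * L%:R + 1) - L%:R) <= tau%:R * (3 * L%:R / P%:R).
  rewrite ler_wpM2l//.
  have -> : n%:R * (2 * delta * L%:R + 1) - L%:R = (2 * n%:R * delta - 1) * L%:R + n%:R by ring.
  rewrite n2delta addrAC subrr add0r.
  have nL : n%:R <= L%:R / P%:R :> R by rewrite ler_pdivlMr// -natrM ler_nat.
  rewrite [leRHS](_ : _ = 2 / P%:R * L%:R + L%:R / P%:R); first by rewrite lerD2l.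
  by ring.
have hi2 : (d * n * d ^ tau * (4 * L))%:R / ((m ^ K).+1 ^ tau)%:R <= d%:R * L%:R / (16 * n%:R) :> R.
  rewrite ler_pdivrMr ?ltr0n ?expn_gt0// mulrAC ler_pdivlMr ?mulr_gt0// -!natrM ler_nat.
  have n2 : (64 * n ^ 2 <= m ^ tau)%N.
    apply: (@leq_trans (64 * ((2 * m) ^ (3 * K)) ^ 2)); first by rewrite leq_mul2l leq_exp2r ?n_le.
    rewrite -expnM expnMn /tau addn1 [leqRHS]expnS (_ : 3 * K * 2 = 6 * K)%N; last by clear; lia.
    rewrite mulnA leq_mul2r (_ : 2 ^ (6 * K) = 64 ^ K)%N ?expnM//; apply/orP; right; apply: leq_trans m_ge.
    by move: (64 ^ K)%N => x; clear - K0; nia.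
  have dtau : (m ^ tau * d ^ tau <= (m ^ K).+1 ^ tau)%N.
    by rewrite -expnMn -expnS prednK// leq_exp2r// /tau addn1.
  have := leq_trans (leq_mul n2 (leqnn (d ^ tau))) dtau.
  move=> /(leq_mul (leqnn (d * L))); rewrite [(n ^ 2)%N]expnS expn1.
  by move: (d ^ tau)%N (_ ^ tau)%N => x y; clear; lia.
have {lo hi1 hi2 count} : d%:R * L%:R / (16 * n%:R) <= tau%:R * (3 * L%:R / P%:R) :> R.
  have : d%:R * L%:R / (8 * n%:R) = d%:R * L%:R / (16 * n%:R) + d%:R * L%:R / (16 * n%:R) :> R.
    by field; rewrite gt_eqF.
  by lra.
rewrite ler_pdivrMr ?mulr_gt0// [leRHS](_ : _ = (48 * tau * n)%:R / P%:R * L%:R); last first.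
  by rewrite !natrM; ring.
rewrite ler_pM2r// ler_pdivlMr// -natrM ler_nat leqNgt => /negP; apply.
apply: (@leq_ltn_trans (48 * (7 * K) * (8 ^ K * m ^ (3 * K)))).
  by rewrite leq_mul ?leq_mul// (leq_trans n_le)// expnMn -[8%N]/(2 ^ 3)%N -expnM.
rewrite /d /P -expnD (_ : K.-1 + (2 * K + 8) = 3 * K + 7)%N; last by clear - K0; lia.
rewrite expnD mulnA [ltnRHS]mulnC ltn_pmul2r ?expn_gt0 ?m0//.
apply: (@leq_trans m); last exact: mX.
apply: leq_trans m_ge.
have : (8 ^ K <= 64 ^ K)%N by rewrite leq_exp2r.
have : (0 < 64 ^ K)%N by rewrite expn_gt0.
by move: (8 ^ K)%N (64 ^ K)%N => x y; clear - K0; nia.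
Qed.

(** Since [n <= 2^m], the number [M] has binary logarithm at most [m (m^K + 5)]. Each speed
    contributes [2d] times this, with leading term [2 m^(2K)]. *)
Lemma bad_prime_bound (K m n d : nat) :
    (1 < K)%N -> (100 <= m)%N -> (m ^ (3 * K) <= n)%N -> (n <= 2 ^ m)%N -> (d <= m ^ K.-1)%N ->
  ((m ^ K)`! * (16 * n * (((m ^ K)`! * n ^ 5) ^ d * ((m ^ K)`! * n ^ 5) ^ d)) ^ n
    <= 2 ^ (4 * n * m ^ (2 * K)))%N.
Proof.
move=> K1 m_ge n_ge n_le d_le; set r := (m ^ K)%N; set M := (r`! * n ^ 5)%N.
have m0 : (0 < m)%N by lia.
have r_n : (r <= n)%N by apply: leq_trans n_ge; rewrite leq_pexp2l//; lia.
have r_fact : (r`! <= 2 ^ (m * r))%N.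
  by rewrite (leq_trans (leq_fact_exp r))// expnM leq_exp2r ?expn_gt0 ?m0// (leq_trans r_n).
have M_le : (M <= 2 ^ (m * r + m * 5))%N.
  by rewrite expnD leq_mul// [leqRHS]expnM leq_exp2r.
pose q := (m ^ K.-1)%N.
have q_ge : (m <= q)%N by rewrite /q -{1}[m]expn1 leq_pexp2l//; lia.
have rE : r = (m * q)%N by rewrite /r /q -expnS prednK//; lia.
have AE : (m ^ (2 * K) = (m * q) * (m * q))%N.
  by rewrite -rE mul2n -addnn expnD.
have M0 : (0 < M)%N by rewrite muln_gt0 fact_gt0 expn_gt0 (leq_trans _ n_ge) ?expn_gt0 ?m0.
have Md_le : (M ^ d * M ^ d <= 2 ^ ((m * r + m * 5) * (q + q)))%N.
  rewrite -expnD (@leq_trans (M ^ (q + q))) ?leq_pexp2l ?leq_add//.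
  by rewrite expnM leq_exp2r//; lia.
have n0 : (0 < n)%N by apply: leq_trans n_ge; rewrite expn_gt0 m0.
apply: (@leq_trans (2 ^ (m * r) * (2 ^ (4 + m + (m * r + m * 5) * (q + q))) ^ n)).
  rewrite leq_mul// leq_exp2r// [leqRHS]expnD leq_mul//.
  by rewrite [leqRHS]expnD leq_mul.
rewrite -expnM -expnD leq_exp2l// AE rE.
move: m_ge q_ge n0; clear; move=> m_ge q_ge n0.
have h1 : (m * (m * q) <= n * (m * q * (m * q)))%N.
  by rewrite (@leq_trans (m * q * (m * q)))//; nia.
have h2 : (4 + m + m * 5 * (q + q) <= m * q * (m * q))%N.
  by have : (100 * (m * q) <= m * q * (m * q))%N; nia.
have h3 : (4 + m + (m * (m * q) + m * 5) * (q + q) <= 3 * (m * q * (m * q)))%N by nia.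
have := leq_mul (leqnn n) h3; nia.
Qed.

(** This is the prime count for [J = m^(2K+3)]: prime divisors cost order [n m^(2K+1)] and excluded
    classes at most [2n m^(2K+2)], out of [2n m^(2K+3)]. *)
Lemma good_prime_room (K m n s : nat) : (100 <= m)%N -> (0 < n)%N -> (s * m ^ 2 <= n)%N ->
  (2 * m * (4 * n * m ^ (2 * K) + m ^ (2 * K + 3) * s).+1 < n.*2 * m ^ (2 * K + 3))%N.
Proof.
rewrite expnD; move: (m ^ (2 * K))%N (expn_gt0 m (2 * K)) => A + m_ge n0.
rewrite (_ : (0 < m)%N)//=; last by lia.
move=> A0 sn; rewrite -muln2 !expnS expn0 !muln1 in sn *.
have h1 : (2 * m * (A * (m * (m * m)) * s) <= 2 * (A * (m * m)) * n)%N.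
  by have := leq_mul (leqnn (2 * (A * (m * m)))) sn; lia.
have nA : (1 <= n * A)%N by rewrite muln_gt0 n0 A0.
have h2 : (2 * m * (4 * n * A) + 2 * m <= 10 * m * (n * A))%N by nia.
have h3 : (10 * m * (n * A) + 2 * (m * m * (n * A)) < n * A * (2 * (m * (m * m))))%N.
  have : (10 * m + 2 * (m * m) < 2 * (m * (m * m)))%N by nia.
  by rewrite -(ltn_pmul2l nA); lia.
lia.
Qed.

Lemma low_dim_lonely (R : realType) (I : finType) (v : I -> nat) (S : {set I})
    (c : I -> nat) (e : I -> I -> int) (K m : nat) :
    (1 < K)%N -> (100 <= m)%N ->
    (m ^ (3 * K) <= #|I|)%N -> (#|I| <= 2 ^ m)%N -> (2 * m ^ (2 * K + 3) <= 2 ^ m)%N ->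
    (forall i, 0 < v i)%N -> (forall i, 0 < c i <= m ^ K)%N ->
    (forall i j, `|e i j|%N <= m ^ K)%N ->
    (forall i, (c i * v i)%:Z = \sum_(j in S) e i j * (v j)%:Z) ->
    (#|S| <= m ^ K.-1)%N ->
  exists t : R, forall i,
    1 / (2 * #|I|%:R) + 1 / (#|I|%:R * (m ^ (2 * K + 8))%:R) <= dist_int (t * (v i)%:R).
Proof.
set n := #|I|; move=> K1 m_ge n_ge n_le J_le v_gt0 c_r e_le relE d_le.
have m0 : (0 < m)%N by lia.
have n0 : (0 < n)%N by apply: leq_trans n_ge; rewrite expn_gt0 m0.
(* The factorial in [M] cancels the one in the error term, and [n ^ 5] makes the rest negligible.
   With [s] about [n / m^2], the excluded classes are sparser than the primes. *)
pose r := (m ^ K)%N; pose M := (r`! * n ^ 5)%N; pose s := (n %/ m ^ 2)%N.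
have m2 : (0 < m ^ 2)%N by rewrite expn_gt0 m0.
have sn : (s * m ^ 2 <= n)%N by exact: leq_divM.
have ns : (n < s.+1 * m ^ 2)%N by exact: ltn_ceil.
have n_ge6 : (m ^ 6 <= n)%N by apply: leq_trans n_ge; rewrite leq_pexp2l//; lia.
have s3 : (3 <= s)%N.
  rewrite leq_divRL// (leq_trans _ n_ge6)// -[6%N]/(4 + 2)%N expnD leq_mul//.
  by rewrite (@leq_trans m)//; [lia|rewrite -{1}[m]expn1 leq_pexp2l].
have dr_n : (#|S| * r <= n)%N.
  apply: (@leq_trans (m ^ K.-1 * m ^ K)); first by rewrite leq_mul2r d_le orbT.
  by rewrite -expnD (leq_trans _ n_ge)// leq_pexp2l//; lia.
have M0 : (0 < M)%N by rewrite muln_gt0 fact_gt0 expn_gt0 n0.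
have n2 : (2 <= n)%N.
  by apply: leq_trans n_ge6; rewrite (@leq_trans m)//; [lia|rewrite -{1}[m]expn1 leq_pexp2l].
have M_ge : (#|S| * r * 2 <= M)%N.
  rewrite (@leq_trans (n ^ 2))//; first by rewrite expnS expn1 leq_mul.
  by rewrite (@leq_trans (n ^ 5)) ?leq_pexp2l// /M leq_pmull ?fact_gt0.
have J0 : (0 < m ^ (2 * K + 3))%N by rewrite expn_gt0 m0.
have Xl : (n.*2 * m ^ (2 * K + 3) <= 2 ^ (2 * m))%N.
  by rewrite -muln2 -mulnA [(2 * m)%N]mul2n -addnn [leqRHS]expnD leq_mul.
have s0 : (0 < s)%N by lia.
have [t tP] := @low_rank_lonely R I v S r M c e s (m ^ (2 * K + 3)) (2 * m)
  (4 * n * m ^ (2 * K)) n0 v_gt0 c_r e_le relE M0 M_ge s0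
  (bad_prime_bound K1 m_ge n_ge n_le d_le) J0 Xl (good_prime_room K m_ge n0 sn).
exists t => i; apply: le_trans (tP i); rewrite -/n -addrA lerD2l.
set P := (m ^ (2 * K + 8))%N.
have PE : P = (m ^ (2 * K + 3) * m ^ 5)%N by rewrite -expnD -addnA.
have P_le : (P <= n ^ 2)%N.
  rewrite (@leq_trans ((m ^ (3 * K)) ^ 2)) ?leq_exp2r//.
  by rewrite -expnM leq_pexp2l//; lia.
have nR : (0 : R) < n%:R by rewrite ltr0n.
have PR : (0 : R) < P%:R by rewrite ltr0n expn_gt0 m0.
have JR : (0 : R) < (m ^ (2 * K + 3))%:R by rewrite ltr0n.
(* The right side is about [1 / (4n m^(2K+5))]; the three further powers of [m] in [P] absorb the
   constants. Half of the gain pays for [loss]. *)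
have gain : 2 / (n%:R * P%:R) <= (s%:R - 1) / (2 * n%:R * (n.*2 * m ^ (2 * K + 3))%:R) :> R.
  have -> : s%:R - 1 = (s.-1)%:R :> R by rewrite -subn1 natrB.
  have X0 : (0 : R) < (n.*2 * m ^ (2 * K + 3))%:R by rewrite ltr0n muln_gt0 double_gt0 n0.
  rewrite ler_pdivrMr ?mulr_gt0// mulrAC ler_pdivlMr ?mulr_gt0//.
  rewrite -!natrM ler_nat PE -muln2.
  have h : (8 * n <= s.-1 * m ^ 5)%N.
    rewrite -[5%N]/(2 + 3)%N expnD; have m3 : (16 <= m ^ 3)%N.
      by rewrite (@leq_trans m)//; [lia|rewrite -{1}[m]expn1 leq_pexp2l].
    move: (m ^ 3)%N (m ^ 2)%N m3 ns s3 => x y; clear; case: s => // s.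
    by rewrite /= => x16 ns s3; have := leq_mul (leqnn (s * y)) x16; nia.
  have := leq_mul (leqnn (n * m ^ (2 * K + 3))) h.
  by move: (m ^ (2 * K + 3))%N (m ^ 5)%N s.-1 => x y z; clear; lia.
have loss : r`!%:R * (2 * (#|S|%:R * r%:R / M%:R)) <= 1 / (n%:R * P%:R) :> R.
  have f0 : (0 : R) < r`!%:R by rewrite ltr0n fact_gt0.
  have -> : r`!%:R * (2 * (#|S|%:R * r%:R / M%:R)) = (2 * (#|S| * r))%:R / (n ^ 5)%:R :> R.
    rewrite /M [(_ * n ^ 5)%:R]natrM !natrM; field.
    by rewrite !gt_eqF// ltr0n expn_gt0 n0.
  rewrite ler_pdivrMr ?ltr0n ?expn_gt0 ?n0// mulrC mulrA ler_pdivlMr ?mulr_gt0// mulr1.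
  rewrite -!natrM ler_nat.
  have := leq_mul (leq_mul n2 dr_n) (leq_mul (leqnn n) P_le).
  by rewrite -expnS mulnn -expnD.
have : 2 / (n%:R * P%:R) = 1 / (n%:R * P%:R) + 1 / (n%:R * P%:R) :> R.
  by rewrite -mulrDl.
by lra.
Qed.

(** * Combination of the two cases *)

Lemma ex_lonely_time (R : realType) (K : nat) : (1 < K)%N -> exists m0 : nat,
  forall (m : nat) (I : finType) (v : I -> nat), (m0 <= m)%N ->
    (m ^ (3 * K) <= #|I| <= (2 * m) ^ (3 * K))%N -> (forall i, 0 < v i)%N ->
  exists t : R, forall i,
    1 / (2 * #|I|%:R) + 1 / (#|I|%:R * (m ^ (2 * K + 8))%:R) <= dist_int (t * (v i)%:R).
Proof.
(* The first two summands are the thresholds of the two cases; the last two feed [leq_poly_exp2]. *)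
move=> K1; exists (512 * (64 ^ K * K) + 100 + 2 ^ (3 * K) * (3 * K).+1 ^ (3 * K).+1
  + 2 * (2 * K + 3).+1 ^ (2 * K + 3).+1)%N => m I v m_ge nm v_gt0.
have K0 : (0 < K)%N by exact: ltnW.
have [m1 m2 m3 m4] : [/\ (512 * (64 ^ K * K) <= m)%N, (100 <= m)%N,
    (2 ^ (3 * K) * (3 * K).+1 ^ (3 * K).+1 <= m)%N &
    (2 * (2 * K + 3).+1 ^ (2 * K + 3).+1 <= m)%N].
  move: m_ge; move: (512 * _)%N (2 ^ _ * _)%N (2 * _ ^ _)%N => x y z; clear.
  by split; lia.
have E1 : ((2 * m) ^ (3 * K) <= 2 ^ m)%N by rewrite expnMn leq_poly_exp2.
have E2 : (2 * m ^ (2 * K + 3) <= 2 ^ m)%N by rewrite leq_poly_exp2.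
have /andP[n_ge n_le] := nm.
have m0 : (0 < m)%N by rewrite (leq_trans _ m2).
have r0 : (0 < m ^ K)%N by rewrite expn_gt0 m0.
have [S [disS relS]] := ex_max_dissociated v r0.
have [S_ge|/ltnW S_le] := leqP (m ^ K.-1) #|S|.
  exact: dissociated_lonely K0 m1 nm v_gt0 disS S_ge.
have [c /choice[e ceP]] := choice relS.
apply: (@low_dim_lonely R I v S c e K m) => //; first exact: leq_trans n_le E1.
- by move=> i; have [] := ceP i.
- by move=> i j; have [_ ->] := ceP i.
- by move=> i; have [] := ceP i.
Qed.

Lemma ex_root_floor k n : (0 < k)%N -> exists m, (m ^ k <= n < m.+1 ^ k)%N.
Proof.
move=> k0; have ub i : (i ^ k <= n)%N -> (i <= n)%N.
  by case: i => // i; apply: leq_trans; rewrite -{1}[i.+1]expn1 leq_pexp2l.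
have ex0 : exists i, (i ^ k <= n)%N by exists 0%N; rewrite exp0n.
have [m mn mmax] := ex_maxnP ex0 ub.
by exists m; rewrite mn ltnNge; apply/negP => /mmax; rewrite ltnn.
Qed.

Theorem theorem1p3 (R : realType) (eps : R) (heps : 0 < eps) :
  exists n0 : nat, forall (n : nat) (V : {fset nat}),
    (n0 <= n)%N ->
    #|` V| = n ->
    (forall v, v \in V -> (0 < v)%N) ->
    ML R V >= 1 / (2 * n%:R) + 1 / (n%:R `^ (5 / 3 + eps)).
Proof.
(* As [m^(3K) <= n], the bound [10 <= 3 K eps] gives [m^(2K+8) <= n^(2/3+eps)]; the [.+2] secures
   [1 < K]. *)
pose K := (Num.truncn (10 / (3 * eps))).+2.
have Keps : 10 <= 3 * K%:R * eps.
  have := truncnS_gt (10 / (3 * eps)); rewrite ltr_pdivrMr ?mulr_gt0// => h.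
  have : (Num.truncn (10 / (3 * eps))).+1%:R <= K%:R :> R by rewrite ler_nat.
  by move=> /(ler_wpM2r (ltW heps)); lra.
have [m0 lonely] := ex_lonely_time R (isT : (1 < K)%N).
(* Together with [n < (m+1)^(3K)] this forces [m0 < m]. *)
exists (m0.+1 ^ (3 * K))%N => n V n_ge Vn V_gt0.
have k0 : (0 < 3 * K)%N by rewrite muln_gt0.
have [m /andP[mn nm]] := ex_root_floor n k0.
have m_ge : (m0 < m)%N by rewrite -ltnS -(ltn_exp2r _ _ k0) (leq_ltn_trans n_ge).
have mpos : (0 < m)%N by exact: leq_ltn_trans m_ge.
have n_le : (n <= (2 * m) ^ (3 * K))%N.
  by rewrite (leq_trans (ltnW nm))// leq_exp2r// mul2n -addnn -addn1 leq_add2l.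
have npos : (0 < n)%N by apply: leq_trans mn; rewrite expn_gt0 mpos.
have V0 : V != fset0 by rewrite -cardfs_gt0 Vn.
have [||t tP] := lonely m V (fun x => fsval x) (ltnW m_ge).
- by rewrite -cardfE Vn mn n_le.
- by move=> x; apply: V_gt0; exact: fsvalP.
have [t0 -> tmax] := ML_max R V0.
apply: le_trans (tmax t); have [u uV ->] := loneliness_at_min t V0.
apply: le_trans (tP [` uV]%fset); rewrite -cardfE Vn lerD2l.
have nR : (0 : R) < n%:R by rewrite ltr0n.
have mR : (0 : R) < m%:R by rewrite ltr0n.
rewrite !div1r lef_pV2 ?posrE ?powR_gt0 ?mulr_gt0 ?ltr0n ?expn_gt0 ?mpos//.
have -> : 5 / 3 + eps = 1 + (2 / 3 + eps) by lra.
rewrite powRD; last by rewrite (gt_eqF nR) implybT.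
rewrite powRr1 ?(ltW nR)// ler_pM2l//.
apply: (@le_trans _ _ ((m ^ (3 * K))%:R `^ (2 / 3 + eps))); last first.
  by rewrite ge0_ler_powR ?nnegrE ?ler_nat//; lra.
rewrite !natrX -!powR_mulrn ?(ltW mR)// -powRrM.
by apply: ler_powR; rewrite ?ler1n// natrD !natrM; lra.
Qed.
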